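(* Let $\pi:M(c)\to N$ be an anti-invariant submersion from a quaternionic space form $(M(c),g_M)$ onto a Riemannian manifold $(N,g_N)$, and let $\ell=\dim(\ker\pi_* )^\perp$. Then for every unit horizontal vector $X$ of $M(c)$ and every orthonormal basis $\{X_1,\dots,X_\ell\}$ of the horizontal space at its base point, $$Ric^*(X)\ \le\ \frac c4\Big\{(\ell-1)+\sum_{j=1}^{\ell}\sum_{\alpha=1}^3 3\,g_M(C_{J_\alpha}X,X_j)^2\Big\}.$$ Equality holds (for every unit horizontal vector $X$) if and only if the horizontal distribution $\mathcal H$ is integrable.
   Context: An almost quaternionic Hermitian manifold $(M,E,g_M)$ is a $4m$-dimensional Riemannian manifold with a rank 3 subbundle $E\subset \mathrm{End}(TM)$ having, near each point, a local basis $\{J_1,J_2,J_3\}$ of sections with $J_\alpha^2=-\mathrm{id}$, $J_\alpha J_{\alpha+1}=-J_{\alpha+1}J_\alpha=J_{\alpha+2}$ (indices mod 3) and $g_M(J_\alpha X,J_\alpha Y)=g_M(X,Y)$. It is quaternionic Kähler if there are local 1-forms $\omega_1,\omega_2,\omega_3$ with $\nabla_XJ_\alpha=\omega_{\alpha+2}(X)J_{\alpha+1}-\omega_{\alpha+1}(X)J_{\alpha+2}$, $\nabla$ the Levi-Civita connection. A quaternionic space form $M(c)$ ($c\in\mathbb R$) is a quaternionic Kähler manifold whose curvature tensor is $$R(X,Y)Z=\tfrac c4\Big\{g_M(Y,Z)X-g_M(X,Z)Y+\sum_{\alpha=1}^3\big(g_M(J_\alpha Y,Z)J_\alpha X-g_M(J_\alpha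 X,Z)J_\alpha Y+2g_M(J_\alpha Y,X)J_\alpha Z\big)\Big\}.$$ A Riemannian submersion $\pi:(M,g_M)\to(N,g_N)$ ($\dim M>\dim N$) is a smooth surjective map of maximal rank whose differential restricted to $(\ker\pi_* )^\perp$ is a linear isometry. Write $\mathcal V=\ker\pi_*$ (vertical), $\mathcal H=(\ker\pi_* )^\perp$ (horizontal), and use the same letters for the orthogonal projections. The submersion $\pi$ is anti-invariant if $J_\alpha(\ker\pi_* )\subset(\ker\pi_* )^\perp$ for $\alpha=1,2,3$. For horizontal $X$ write $J_\alpha X=B_{J_\alpha}X+C_{J_\alpha}X$ with $B_{J_\alpha}X$ vertical and $C_{J_\alpha}X$ horizontal. O'Neill tensor: $\mathcal A_EF=\mathcal H\nabla_{\mathcal HE}\mathcal VF+\mathcal V\nabla_{\mathcal HE}\mathcal HF$. The horizontal distribution is integrable iff $\mathcal A$ vanishes identically. Curvature convention: $R(X,Y,Z,W)=g_M(R(X,Y)Z,W)$, and the curvature tensor $R^*$ of the horizontal distribution (the horizontal lift of the curvature tensor $R'$ of $N$: $\pi_*(R^*(X,Y)Z)=R'(\pi_*X,\pi_*Y)\pi_*Z$) is related to $R$ by $$R(X,Y,Z,W)=R^*(X,Y,Z,W)-2g_M(\mathcal A_XY,\mathcal A_ZW)+g_M(\mathcal A_YZ,\mathcal A_XW)-g_M(\mathcal A_XZ,\mathcal A_YW)$$ for horizontal $X,Y,Z,W$; the sign of the curvature tensors is the one for which this holds, i.e. $R(X,Y)Z=\nabla_{[X,Y]}Z-\nabla_X\nabla_YZ+\nabla_Y\nabla_XZ$.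 Finally $Ric^*(X)=\sum_{j=1}^\ell R^*(X,X_j,X_j,X)$. *)

(* Defs.v *)
From HB Require Import structures.
From mathcomp Require Import all_boot all_order all_algebra.
From mathcomp Require Import all_classical all_reals all_analysis.

Set Implicit Arguments.
Unset Strict Implicit.
Unset Printing Implicit Defensive.

Import Order.TTheory GRing.Theory Num.Theory.
Import numFieldNormedType.Exports.

Local Open Scope classical_set_scope.
Local Open Scope ring_scope.

Section Smooth.
Context {R : realType} {V W : normedModType R}.

(* C^k on an open set [S]; only used for finite-dimensional [V]. *)
Fixpoint Ck_on (k : nat) (S : set V) (f : V -> W) : Prop :=
  match k with
  | 0 => forall x, S x -> {for x, continuous f}
  | k'.+1 => (forall x, S x -> differentiable f x) /\
             (forall v, Ck_on k' S ('D_v f))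
  end.

Definition smooth_on (S : set V) (f : V -> W) : Prop :=
  forall k, Ck_on k S f.

End Smooth.

(* The inverse [unchart] is a total function, meaningful only on
   [chart_map @` chart_dom]. *)
Record chart (R : realType) (M : topologicalType) (n : nat) := Chart {
  chart_dom : set M ;
  chart_map :> M -> 'rV[R]_n ;
  unchart : 'rV[R]_n -> M ;
  open_chart_dom : open chart_dom ;
  open_chart_image : open (chart_map @` chart_dom) ;
  chartK : forall p, chart_dom p -> unchart (chart_map p) = p ;
  chart_continuous : forall p, chart_dom p -> {for p, continuous chart_map} ;
  unchart_continuous :
    forall p, chart_dom p -> {for chart_map p, continuous unchart} }.

(* [chart_at p] is a preferred chart around [p].  It is used to identify the
   tangent space at [p] with 'rV[R]_n: a tangent vector at [p] is represented
   by its coordinates in [chart_at p]. *)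
Record manifold (R : realType) (n : nat) := Manifold {
  points :> topologicalType ;
  atlas : set (chart R points n) ;
  chart_at : points -> chart R points n ;
  manifold_hausdorff : hausdorff_space points ;
  manifold_second_countable : @second_countable points ;
  atlas_chart_at : forall p, atlas (chart_at p) ;
  dom_chart_at : forall p, chart_dom (chart_at p) p ;
  atlas_compatible : forall a b, atlas a -> atlas b ->
    smooth_on (a @` (chart_dom a `&` chart_dom b)) (b \o unchart a) }.

Section TangentCalculus.
Context {R : realType} {n : nat} {M : manifold R n}.

(* Coordinates in [a] of the tangent vector at [p] whose coordinates in
   [chart_at p] are [v]. *)
Definition tangent_coord (a : chart R M n) (p : M) (v : 'rV[R]_n) : 'rV[R]_n :=
  'd (a \o unchart (chart_at p)) (chart_at p p) v.

(* Vector fields are functions [X : M -> 'rV[R]_n], [X p] being a tangent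
   vector at [p].  A field on an open set [U] is a total function whose values
   outside [U] are irrelevant. *)
Definition field_in_chart (a : chart R M n) (X : M -> 'rV[R]_n) :
    'rV[R]_n -> 'rV[R]_n :=
  fun x => tangent_coord a (unchart a x) (X (unchart a x)).

Definition smooth_fun (U : set M) (f : M -> R) : Prop :=
  forall a, atlas a -> smooth_on (a @` (chart_dom a `&` U)) (f \o unchart a).

Definition smooth_field (U : set M) (X : M -> 'rV[R]_n) : Prop :=
  forall a, atlas a ->
    smooth_on (a @` (chart_dom a `&` U)) (field_in_chart a X).

Definition field_deriv (X : M -> 'rV[R]_n) (f : M -> R) (p : M) : R :=
  'D_(X p) (f \o unchart (chart_at p)) (chart_at p p).

(* [X, Y] = D_X Y - D_Y X, computed at [p] in [chart_at p]. *)
Definition lie_bracket (X Y : M -> 'rV[R]_n) (p : M) : 'rV[R]_n :=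
  'D_(X p) (field_in_chart (chart_at p) Y) (chart_at p p)
  - 'D_(Y p) (field_in_chart (chart_at p) X) (chart_at p p).

(* The field around [p] with constant coordinates [v] in [chart_at p]. *)
Definition extend_tangent (p : M) (v : 'rV[R]_n) : M -> 'rV[R]_n :=
  fun q => 'd (chart_at q \o unchart (chart_at p)) (chart_at p q) v.

(* Smooth local sections of End(TM) and of T*M, tested on smooth fields. *)
Definition smooth_endo (U : set M) (J : M -> 'End('rV[R]_n)) : Prop :=
  forall W X, open W -> W `<=` U -> smooth_field W X ->
    smooth_field W (fun p => J p (X p)).

Definition smooth_form (U : set M) (w : M -> 'Hom('rV[R]_n, R^o)) : Prop :=
  forall W X, open W -> W `<=` U -> smooth_field W X ->
    smooth_fun W (fun p => w p (X p)).

End TangentCalculus.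

Record metric (R : realType) (n : nat) (M : manifold R n) := Metric {
  metric_form : M -> 'Hom('rV[R]_n, 'Hom('rV[R]_n, R^o)) ;
  metric_sym : forall p x y, metric_form p x y = metric_form p y x ;
  metric_pos : forall p x, x != 0 -> (0 : R) < metric_form p x x ;
  metric_smooth : forall U X Y, open U -> smooth_field U X ->
    smooth_field U Y -> smooth_fun U (fun p => metric_form p (X p) (Y p)) }.

Definition inner (R : realType) (n : nat) (M : manifold R n) (g : metric M)
    (p : M) (x y : 'rV[R]_n) : R :=
  metric_form g p x y.

Section Connections.
Context {R : realType} {n : nat} {M : manifold R n}.

(* [nabla X Y] is the covariant derivative of [Y] along [X].  The axioms are
   stated for fields that are smooth on an arbitrary open set, i.e. [nabla]
   comes with its restrictions to open sets. *)
Record is_connection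
    (nabla : (M -> 'rV[R]_n) -> (M -> 'rV[R]_n) -> M -> 'rV[R]_n) : Prop := {
  connection_smooth : forall U X Y, open U ->
    smooth_field U X -> smooth_field U Y -> smooth_field U (nabla X Y) ;
  connectionDl : forall U X X' Y, open U ->
    smooth_field U X -> smooth_field U X' -> smooth_field U Y ->
    forall p, U p ->
      nabla (fun q => X q + X' q) Y p = nabla X Y p + nabla X' Y p ;
  connectionZl : forall U f X Y, open U ->
    smooth_fun U f -> smooth_field U X -> smooth_field U Y ->
    forall p, U p -> nabla (fun q => f q *: X q) Y p = f p *: nabla X Y p ;
  connectionDr : forall U X Y Y', open U ->
    smooth_field U X -> smooth_field U Y -> smooth_field U Y' ->
    forall p, U p ->
      nabla X (fun q => Y q + Y' q) p = nabla X Y p + nabla X Y' p ;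
  connection_leibniz : forall U f X Y, open U ->
    smooth_fun U f -> smooth_field U X -> smooth_field U Y ->
    forall p, U p ->
      nabla X (fun q => f q *: Y q) p =
        field_deriv X f p *: Y p + f p *: nabla X Y p }.

Record levi_civita (g : metric M)
    (nabla : (M -> 'rV[R]_n) -> (M -> 'rV[R]_n) -> M -> 'rV[R]_n) : Prop := {
  levi_civita_connection : is_connection nabla ;
  torsion_free : forall U X Y, open U ->
    smooth_field U X -> smooth_field U Y ->
    forall p, U p -> nabla X Y p - nabla Y X p = lie_bracket X Y p ;
  metric_compatible : forall U X Y Z, open U ->
    smooth_field U X -> smooth_field U Y -> smooth_field U Z ->
    forall p, U p ->
      field_deriv X (fun q => inner g q (Y q) (Z q)) p =
        inner g p (nabla X Y p) (Z p) + inner g p (Y p) (nabla X Z p) }.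

(* Sign convention: R(X,Y)Z = nabla_[X,Y] Z - nabla_X nabla_Y Z
   + nabla_Y nabla_X Z. *)
Definition curvature_field
    (nabla : (M -> 'rV[R]_n) -> (M -> 'rV[R]_n) -> M -> 'rV[R]_n)
    (X Y Z : M -> 'rV[R]_n) (p : M) : 'rV[R]_n :=
  nabla (lie_bracket X Y) Z p - nabla X (nabla Y Z) p + nabla Y (nabla X Z) p.

(* R(x,y)z on tangent vectors at [p]; by tensoriality the extension of the
   vectors to fields is immaterial. *)
Definition curvature
    (nabla : (M -> 'rV[R]_n) -> (M -> 'rV[R]_n) -> M -> 'rV[R]_n)
    (p : M) (x y z : 'rV[R]_n) : 'rV[R]_n :=
  curvature_field nabla
    (extend_tangent p x) (extend_tangent p y) (extend_tangent p z) p.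

End Connections.

Section Quaternionic.
Context {R : realType} {m : nat} {M : manifold R (4 * m)%N}.
Variables (g : metric M) (E : M -> {vspace 'End('rV[R]_(4 * m)%N)}).

(* {J_1, J_2, J_3} over U; the indices mod 3 live in 'Z_3. *)
Record canonical_basis (U : set M)
    (J : 'Z_3 -> M -> 'End('rV[R]_(4 * m)%N)) : Prop := {
  canonical_open : open U ;
  canonical_smooth : forall a, smooth_endo U (J a) ;
  canonical_basis_of : forall p, U p ->
    basis_of (E p) [seq J a p | a <- enum 'Z_3] ;
  canonical_sqr : forall p a x, U p -> J a p (J a p x) = - x ;
  canonical_mul : forall p a x, U p -> J a p (J (a + 1) p x) = J (a + 2) p x ;
  canonical_anti : forall p a x, U p ->
    - J (a + 1) p (J a p x) = J (a + 2) p x ;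
  canonical_hermitian : forall p a x y, U p ->
    inner g p (J a p x) (J a p y) = inner g p x y }.

Definition almost_quaternionic_hermitian : Prop :=
  forall p : M, exists U J, canonical_basis U J /\ U p.

Variable nabla :
  (M -> 'rV[R]_(4 * m)%N) -> (M -> 'rV[R]_(4 * m)%N) -> M -> 'rV[R]_(4 * m)%N.

(* (nabla_X J_a) Y = nabla_X (J_a Y) - J_a (nabla_X Y) *)
Definition quaternionic_kahler : Prop :=
  almost_quaternionic_hermitian /\
  forall U J, canonical_basis U J ->
    exists w : 'Z_3 -> M -> 'Hom('rV[R]_(4 * m)%N, R^o),
      (forall a, smooth_form U (w a)) /\
      forall a W X Y, open W -> W `<=` U ->
        smooth_field W X -> smooth_field W Y ->
        forall p, W p ->
          nabla X (fun q => J a q (Y q)) p - J a p (nabla X Y p) =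
            (w (a + 2) p (X p) : R) *: J (a + 1) p (Y p)
            - (w (a + 1) p (X p) : R) *: J (a + 2) p (Y p).

Definition quaternionic_space_form (c : R) : Prop :=
  quaternionic_kahler /\
  forall U J, canonical_basis U J -> forall p, U p -> forall x y z,
    curvature nabla p x y z =
      (c / 4) *: (inner g p y z *: x - inner g p x z *: y
        + \sum_(a : 'Z_3)
            (inner g p (J a p y) z *: J a p x
             - inner g p (J a p x) z *: J a p y
             + (2 * inner g p (J a p y) x) *: J a p z)).

End Quaternionic.

Section Submersions.
Context {R : realType} {n k : nat} {M : manifold R n} {N : manifold R k}.

Definition smooth_map (f : M -> N) : Prop :=
  continuous f /\
  forall a b, atlas a -> atlas b ->
    smooth_on (a @` (chart_dom a `&` f @^-1` chart_dom b)) (b \o f \o unchart a).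

Definition tangent_map (f : M -> N) (p : M) : 'Hom('rV[R]_n, 'rV[R]_k) :=
  linfun ('d (chart_at (f p) \o f \o unchart (chart_at p)) (chart_at p p)).

Variables (gM : metric M) (gN : metric N) (f : M -> N).

Definition vertical (p : M) : {vspace 'rV[R]_n} := lker (tangent_map f p).

(* The orthogonal complement of [vertical p]: [lker (metric_form gM p v)] is
   the orthogonal of [v]. *)
Definition horizontal (p : M) : {vspace 'rV[R]_n} :=
  (\bigcap_(v <- vbasis (vertical p)) lker (metric_form gM p v))%VS.

Definition hproj (p : M) : 'End('rV[R]_n) :=
  daddv_pi (horizontal p) (vertical p).

Record riemannian_submersion : Prop := {
  submersion_dim : (k < n)%N ;
  submersion_smooth : smooth_map f ;
  submersion_surj : forall q, exists p, f p = q ;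
  submersion_rank : forall p, limg (tangent_map f p) = fullv ;
  submersion_isometry : forall p x y,
    x \in horizontal p -> y \in horizontal p ->
    inner gN (f p) (tangent_map f p x) (tangent_map f p y) = inner gM p x y }.

(* [f] is a submersion, so [(tangent_map f p)^-1] is a right inverse of
   [tangent_map f p]. *)
Definition horizontal_lift (p : M) (w : 'rV[R]_k) : 'rV[R]_n :=
  hproj p ((tangent_map f p)^-1%VF w).

(* R^*: the horizontal lift of the curvature tensor of N. *)
Definition curvature_star
    (nablaN : (N -> 'rV[R]_k) -> (N -> 'rV[R]_k) -> N -> 'rV[R]_k)
    (p : M) (x y z : 'rV[R]_n) : 'rV[R]_n :=
  horizontal_lift p (curvature nablaN (f p)
    (tangent_map f p x) (tangent_map f p y) (tangent_map f p z)).

Definition horizontal_onb (p : M) (l : nat) (X : l.-tuple 'rV[R]_n) : Prop :=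
  basis_of (horizontal p) X /\
  forall i j, inner gM p (tnth X i) (tnth X j) = (i == j)%:R.

Definition ric_star
    (nablaN : (N -> 'rV[R]_k) -> (N -> 'rV[R]_k) -> N -> 'rV[R]_k)
    (p : M) (l : nat) (X : l.-tuple 'rV[R]_n) (x : 'rV[R]_n) : R :=
  \sum_(j < l) inner gM p (curvature_star nablaN p x (tnth X j) (tnth X j)) x.

(* Integrability in the sense of Frobenius: closure under the Lie bracket. *)
Definition horizontal_integrable : Prop :=
  forall U X Y, open U -> smooth_field U X -> smooth_field U Y ->
    (forall p, U p -> X p \in horizontal p /\ Y p \in horizontal p) ->
    forall p, U p -> lie_bracket X Y p \in horizontal p.

End Submersions.

Definition anti_invariant (R : realType) (m k : nat) (M : manifold R (4 * m)%N)
    (N : manifold R k) (gM : metric M)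
    (E : M -> {vspace 'End('rV[R]_(4 * m)%N)}) (f : M -> N) : Prop :=
  forall U J, canonical_basis gM E U J -> forall p, U p ->
    forall a v, v \in vertical f p -> J a p v \in horizontal gM f p.

Definition C_part (R : realType) (n k : nat) (M : manifold R n)
    (N : manifold R k) (gM : metric M) (f : M -> N) (p : M)
    (J : 'End('rV[R]_n)) (x : 'rV[R]_n) : 'rV[R]_n :=
  hproj gM f p (J x).

(* Main.v *)
Require Import Defs.
From HB Require Import structures.
From mathcomp Require Import all_boot all_order all_algebra.
From mathcomp Require Import all_classical all_reals all_analysis.
From mathcomp Require Import ring lra.
Import Order.TTheory GRing.Theory Num.Theory.
Import numFieldNormedType.Exports.
Local Open Scope classical_set_scope.
Local Open Scope ring_scope.

Set Implicit Arguments.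
Unset Strict Implicit.
Unset Printing Implicit Defensive.

(** In charts around [p] and [pi p] everything becomes calculus on open sets of
    coordinate spaces. There, let [X] and [Y] be the horizontal lifts of two
    constant fields [x] and [y]. Then [X, Y] is vertical, Koszul's formula shows
    that [nabla_X Y] projects to [nabla'_x y], and [nabla_X X] is horizontal, so
    that [nabla_X Y = lift (nabla'_x y) + [X, Y] / 2]. Differentiating the inner
    products of these fields gives O'Neill's formula, which in the present sign
    convention reads [R^*(X, Y, Y, X) = R(X, Y, Y, X) - 3/4 |[X, Y]|^2]. Summed
    over an orthonormal basis, the first term is the right-hand side of the
    inequality by the explicit form of [R] and Parseval's identity. Equality
    forces [X, Y] = 0 for all lifts, which is integrability since the vertical
    part of a bracket of horizontal fields is tensorial. *)

(* Otherwise unification unfolds these limits when it compares differentials. *)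
Opaque derive diff.

(** * Differentiation and functions of class C^k *)

(** The diagonal case [nabla_X X] is enough because polarization at [X + Y] gives the symmetric part
    of [nabla_X Y], while torsion-freeness gives [[X, Y]] as its antisymmetric part. The constant
    [3/4] is [1/4 + 1/2]: a quarter of [|[X, Y]|^2] comes from [nabla_Y nabla_X Y], as a product of
    two half-brackets, and a half comes from [nabla_[X, Y] Y]; [nabla_X nabla_Y Y] adds nothing
    since [[Y, Y] = 0]. As [[X, Y] = 2 A_X Y] for these lifts, the correction is the classical
    [3 |A_X Y|^2].

    The obstacle is that a connection acts on total functions, meaningful only where they are
    smooth, and that curvature is defined through one particular extension of the vectors.
    Christoffel symbols turn it into a pointwise expression, which can then be evaluated on
    horizontal lifts instead of coordinate fields. The lifts must be smooth, not merely defined at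
    each point; they are obtained by solving a linear system for the Gram matrix of the metric. *)

Lemma open_near (T : topologicalType) (S : set T) x : open S -> S x -> \near x, S x.
Proof. by move=> oS Sx; exact: open_nbhs_nbhs. Qed.

Section NearEq.
Context {R : realType} {V W : normedModType R}.

(** The first-order expansion of [f] at [x] involves only values near [x], so ['d f x] serves for
    [g] as well; [diff_unique] identifies it with ['d g x]. *)
Lemma near_eq_differentiable (f g : V -> W) x :
  (\near x, f x = g x) -> differentiable f x -> differentiable g x.
Proof.
move=> fg /diff_locallyP[cdf edf].
have fgx : f x = g x by exact: nbhs_singleton fg.
have eg : g \o shift x = cst (g x) + 'd f x +o_ (0 : V) id.
  apply/eqaddoP => e e0.
  move/eqaddoP : edf => /(_ e e0) H.
  have fg0 : \forall h \near (0 : V), f (h + x) = g (h + x).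
    by move: fg; rewrite (near_shift 0 x) /=; apply: filterS => h; rewrite subr0.
  near=> h.
  have -> : (g \o shift x - (cst (g x) + 'd f x)) h =
    (f \o shift x - (cst (f x) + 'd f x)) h.
    rewrite -fgx /=; congr (_ - _). 
    by rewrite !fctE /=; near: h; apply: filterS fg0 => h ->.
  by near: h.
apply/diff_locallyP; rewrite (diff_unique cdf eg); split => //.
Unshelve. all: by end_near. Qed.

Lemma scale_is_bilinear :
  bilinear_for
    (GRing.Scale.Law.clone _ _ *:%R _) (GRing.Scale.Law.clone _ _ *:%R _)
    (fun (k : R) (v : W) => k *: v).
Proof.
split=> [u'|u] a x y /=.
- by rewrite scalerDl scalerA.
- by rewrite scalerDr !scalerA mulrC.
Qed.

(** Leibniz rule, read off the differential of the continuous bilinear map [k, v |-> k *: v] along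
    the pair of [f] and [g]. *)
Lemma deriv_scale (f : V -> R) (g : V -> W) x : differentiable f x ->
  differentiable g x -> differentiable (fun y => f y *: g y) x /\
  forall v, 'D_v (fun y => f y *: g y) x = 'D_v f x *: g x + f x *: 'D_v g x.
Proof.
move=> df dg.
pose bM := bilinear_isBilinear.Build R R W W _ _
  (fun (k : R) (v : W) => k *: v) scale_is_bilinear.
pose b : {bilinear R -> W -> W} := HB.pack (fun (k : R) (v : W) => k *: v) bM.
have cb : continuous (fun p : R * W => b p.1 p.2) by move=> p;
  exact: scale_continuous.
have dfg := differentiable_pair df dg.
have E : (fun y => f y *: g y) = (fun p => b p.1 p.2) \o (fun y => (f y, g y))
  by [].
have db := differentiable_bilin (f x, g x) cb.
have D : differentiable (fun y => f y *: g y) x by rewrite E;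
  exact: differentiable_comp.
split=> // v.
rewrite !deriveE//.
rewrite [in LHS]E diff_comp//= diff_pair//=.
by rewrite (diff_bilin (f x, g x) cb) /= addrC.
Qed.

Lemma Ck_on_sub k (S T : set V) (f : V -> W) :
  T `<=` S -> Ck_on k S f -> Ck_on k T f.
Proof.
move=> TS; elim: k f => [|k IH] f /=; first by move=> h x /TS/h.
by case=> df Df; split=> [x /TS/df //|v]; exact: IH.
Qed.

Lemma Ck_on_pred k (S : set V) (f : V -> W) : Ck_on k.+1 S f -> Ck_on k S f.
Proof.
elim: k f => [|k IH] f /= [df Df].
  by move=> x Sx; apply: differentiable_continuous; exact: df.
by split=> // v; apply: IH; exact: Df.
Qed.

Lemma Ck_on_eq k (S : set V) (f g : V -> W) : open S ->
  (forall x, S x -> f x = g x) -> Ck_on k S f -> Ck_on k S g.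
Proof.
move=> oS; elim: k f g => [|k IH] f g fg /=.
  move=> cf x Sx; rewrite /prop_for /continuous_at -fg//.
  apply: cvg_trans (cf x Sx); apply: near_eq_cvg.
  by apply: filterS (open_near oS Sx) => y /fg.
have fgn x : S x -> \near x, f x = g x.
  by move=> Sx; apply: filterS (open_near oS Sx) => y /fg.
case=> df Df; split=> [x Sx|v].
  by apply: near_eq_differentiable (df x Sx); exact: fgn.
apply: IH (Df v) => x Sx; apply: near_eq_derive; exact: fgn.
Qed.

Lemma Ck_on_cst k (S : set V) (w : W) : Ck_on k S (fun=> w).
Proof.
elim: k w => [|k IH] w /=; first by move=> x _; exact: cvg_cst.
split=> [x _|v]; first exact: differentiable_cst.
by rewrite (_ : 'D_v _ = fun=> 0) //; apply/funext => x; rewrite derive_cst.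
Qed.

Lemma Ck_onD k (S : set V) (f g : V -> W) : open S ->
  Ck_on k S f -> Ck_on k S g -> Ck_on k S (fun x => f x + g x).
Proof.
move=> oS; elim: k f g => [|k IH] f g /=.
  by move=> cf cg x Sx; apply: cvgD; [exact: cf|exact: cg].
move=> [df Df] [dg Dg]; split=> [x Sx|v].
  by apply: differentiableD; [exact: df|exact: dg].
apply: (Ck_on_eq oS _ (IH _ _ (Df v) (Dg v))) => x Sx.
rewrite -[in RHS]/(f + g) deriveD//; apply: diff_derivable; [exact: df|exact: dg].
Qed.

End NearEq.

Section Algebra.
Context {R : realType} {V W : normedModType R}.

(** Each Leibniz term has one undifferentiated factor, whose order [Ck_on_pred] lowers to fit the
    induction hypothesis. *)
Lemma Ck_on_scale k (S : set V) (f : V -> R) (g : V -> W) : open S ->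
  Ck_on k S f -> Ck_on k S g -> Ck_on k S (fun x => f x *: g x).
Proof.
move=> oS; elim: k f g => [|k IH] f g.
  move=> /= cf cg x Sx; apply: (@cvgZ _ _ _ _ _ f g); [exact: cf|exact: cg].
move=> hf hg; have cf := Ck_on_pred hf; have cg := Ck_on_pred hg.
case: hf => df Df; case: hg => dg Dg; split=> [x Sx|v].
  by have [] := deriv_scale (df x Sx) (dg x Sx).
apply: (Ck_on_eq oS _ (Ck_onD oS (IH _ _ (Df v) cg) (IH _ _ cf (Dg v)))) => x Sx.
by have [_ ->] := deriv_scale (df x Sx) (dg x Sx).
Qed.

Lemma Ck_on_sum k (S : set V) I (r : seq I) (P : pred I) (f : I -> V -> W) :
  open S ->
  (forall i, P i -> Ck_on k S (f i)) ->
  Ck_on k S (fun x => \sum_(i <- r | P i) f i x).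
Proof.
move=> oS Cf; elim: r => [|i r IH].
  rewrite (_ : (fun x => _) = fun=> 0); first exact: Ck_on_cst.
  by apply/funext => x; rewrite big_nil.
have [Pi|nPi] := boolP (P i).
  rewrite (_ : (fun x => _) = fun x => f i x + \sum_(i <- r | P i) f i x).
    by apply: Ck_onD => //; exact: Cf.
  by apply/funext => x; rewrite big_cons Pi.
rewrite (_ : (fun x => _) = fun x => \sum_(i <- r | P i) f i x) //.
by apply/funext => x; rewrite big_cons (negbTE nPi).
Qed.

End Algebra.

Section Vectors.
Context {R : realType} {V W : normedModType R}.

Lemma coord_differentiable n (f : V -> 'rV[R]_n) x i :
  differentiable f x -> differentiable (fun y => f y 0 i) x.
Proof.
move=> df.
exact: (differentiable_comp df (differentiable_coord (f x) 0 i)).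
Qed.

Lemma coord_derive n (f : V -> 'rV[R]_n) x v i :
  differentiable f x -> 'D_v (fun y => f y 0 i) x = ('D_v f x) 0 i.
Proof. by move=> df; rewrite derive_mx ?mxE//; exact: diff_derivable. Qed.

Lemma Ck_on_coord k (S : set V) n (f : V -> 'rV[R]_n) i : open S ->
  Ck_on k S f -> Ck_on k S (fun x => f x 0 i).
Proof.
move=> oS; elim: k f => [|k IH] f.
  move=> /= cf x Sx.
  apply: (@continuous_comp _ _ _ f (fun N : 'rV[R]_n => N 0 i) x (cf x Sx)).
  exact: coord_continuous.
case=> df Df; split=> [x Sx|v]; first exact: coord_differentiable (df x Sx).
by apply: (Ck_on_eq oS _ (IH _ (Df v))) => x Sx; rewrite coord_derive//; exact: df.
Qed.

Lemma Ck_on_row k (S : set V) n (f : V -> 'rV[R]_n) : open S ->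
  (forall i, Ck_on k S (fun x => f x 0 i)) -> Ck_on k S f.
Proof.
move=> oS Cf.
rewrite (_ : f = fun x => \sum_(i < n) f x 0 i *: delta_mx 0 i); last first.
  by apply/funext => x; exact: row_sum_delta.
by apply: Ck_on_sum => // i _; apply: Ck_on_scale => //; exact: Ck_on_cst.
Qed.

End Vectors.

Section Families.
Context {R : realType} {V W : normedModType R}.

Lemma deriv_sum n (h : 'I_n -> V -> W) x :
  (forall i, differentiable (h i) x) ->
  differentiable (fun y => \sum_(i < n) h i y) x /\
  forall v, 'D_v (fun y => \sum_(i < n) h i y) x = \sum_(i < n) 'D_v (h i) x.
Proof.
move=> dh.
rewrite (_ : (fun y => _) = \sum_(i < n) h i); last first.
  by apply/funext => y; rewrite fct_sumE.
split=> [|v]; first exact: differentiable_sum.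
by rewrite derive_sum// => i; exact: diff_derivable.
Qed.

(** Stated for bare functions with a proof of [linear]: metrics, Christoffel symbols and lifts below
    are plain families of functions, not packaged linear maps. *)
Lemma linear_fun0 (X : lmodType R) (f : X -> W) : linear f -> f 0 = 0.
Proof. by move=> lf; have := lf (-1) 0 0; rewrite scaler0 addr0 scaleN1r addNr. Qed.

Lemma linear_funZ (X : lmodType R) (f : X -> W) : linear f -> forall a u,
  f (a *: u) = a *: f u.
Proof. by move=> lf a u; rewrite -[a *: u]addr0 lf (linear_fun0 lf) addr0. Qed.

Lemma linear_funD (X : lmodType R) (f : X -> W) : linear f -> forall u v,
  f (u + v) = f u + f v.
Proof. by move=> lf u v; rewrite -{1}[u]scale1r lf scale1r. Qed.

Lemma linear_funN (X : lmodType R) (f : X -> W) : linear f -> forall u,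
  f (- u) = - f u.
Proof. by move=> lf u; rewrite -scaleN1r (linear_funZ lf) scaleN1r. Qed.

Lemma linear_funB (X : lmodType R) (f : X -> W) : linear f -> forall u v,
  f (u - v) = f u - f v.
Proof. by move=> lf u v; rewrite (linear_funD lf) (linear_funN lf). Qed.

Lemma linear_fun_sum (X : lmodType R) (f : X -> W) I (r : seq I) (P : pred I)
  (F : I -> X) :
  linear f -> f (\sum_(i <- r | P i) F i) = \sum_(i <- r | P i) f (F i).
Proof.
move=> lf; elim/big_rec2 : _ => [|i y1 y2 _ <-]; first exact: linear_fun0.
exact: linear_funD.
Qed.

Lemma linear_row n (f : 'rV[R]_n -> W) : linear f ->
  forall u, f u = \sum_(i < n) u 0 i *: f (delta_mx 0 i).
Proof.
move=> lf u; rewrite {1}(row_sum_delta u) linear_fun_sum//.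
by apply: eq_bigr => i _; rewrite linear_funZ.
Qed.

Variables (n : nat) (B : V -> 'rV[R]_n -> W).
Hypothesis linB : forall z, linear (B z).

(** Expanding [Y z] in the standard basis reduces the claim to products of scalar and vector
    functions, so [B] need only be differentiable in [z] for each fixed vector. *)
Lemma deriv_app (Y : V -> 'rV[R]_n) z : differentiable Y z ->
  (forall w, differentiable (B ^~ w) z) ->
  differentiable (fun z => B z (Y z)) z /\
  forall u, 'D_u (fun z => B z (Y z)) z = 'D_u (B ^~ (Y z)) z + B z ('D_u Y z).
Proof.
move=> dY dB.
have E Y' : (fun z => B z (Y' z)) =
    fun z => \sum_(i < n) Y' z 0 i *: B z (delta_mx 0 i).
  by apply/funext => y; rewrite (linear_row (linB y)).
have H i := deriv_scale (coord_differentiable i dY) (dB (delta_mx 0 i)).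
have [dS DS] := deriv_sum (fun i => (H i).1).
have H' i := deriv_scale (differentiable_cst (Y z 0 i) z) (dB (delta_mx 0 i)).
have [_ DS'] := deriv_sum (fun i => (H' i).1).
split=> [|u]; first by rewrite E.
rewrite E DS (E (fun=> Y z)) DS' (linear_row (linB z) ('D_u Y z)) -big_split /=.
apply: eq_bigr => i _; rewrite (H i).2 (H' i).2 derive_cst scale0r add0r addrC.
by rewrite coord_derive.
Qed.

Lemma Ck_on_app k (S : set V) (Y : V -> 'rV[R]_n) : open S -> Ck_on k S Y ->
  (forall w, Ck_on k S (B ^~ w)) -> Ck_on k S (fun z => B z (Y z)).
Proof.
move=> oS cY cB.
rewrite (_ : (fun z => _) =
    fun z => \sum_(i < n) Y z 0 i *: B z (delta_mx 0 i)); last first.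
  by apply/funext => y; rewrite (linear_row (linB y)).
by apply: Ck_on_sum => // i _; apply: Ck_on_scale => //; exact: Ck_on_coord.
Qed.

End Families.

Section Chain.
Context {R : realType} {V W : normedModType R}.

Lemma derive_comp (U : normedModType R) (f : V -> U) (g : U -> W) x :
  differentiable f x -> differentiable g (f x) ->
  differentiable (g \o f) x /\
  forall v, 'D_v (g \o f) x = 'D_('D_v f x) g (f x).
Proof.
move=> df dg; have dgf := differentiable_comp df dg.
by split=> // v; rewrite !deriveE// diff_comp.
Qed.

Lemma Ck_on_comp k n (S : set V) (T : set 'rV[R]_n) (f : V -> 'rV[R]_n)
    (g : 'rV[R]_n -> W) : open S -> open T -> (forall x, S x -> T (f x)) ->
  Ck_on k S f -> Ck_on k T g -> Ck_on k S (g \o f).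
Proof.
move=> oS oT ST; elim: k f g ST => [|k IH] f g ST.
  move=> /= cf cg x Sx; apply: continuous_comp; first exact: cf.
  by apply: cg; exact: ST.
move=> cf cg; have cf' := Ck_on_pred cf.
case: cf cg => df Df [dg Dg]; split=> [x Sx|v].
  by apply: (derive_comp (df x Sx) (dg _ (ST x Sx))).1.
(* The direction ['D_v f x] moves with [x], whereas the induction hypothesis concerns derivatives of
   [g] in fixed directions; hence the expansion over the standard basis. *)
apply: (@Ck_on_eq _ _ _ _ _
  (fun x => \sum_(i < n) 'D_v f x 0 i *: ('D_(delta_mx 0 i) g \o f) x)) => //.
  move=> x Sx; rewrite (derive_comp (df x Sx) (dg _ (ST x Sx))).2 [RHS]deriveE;
     last exact: (dg _ (ST x Sx)).
  rewrite (linear_row (f := 'd g (f x))); last exact: linearP.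
  by apply: eq_bigr => i _; rewrite /= [in LHS](deriveE _ (dg _ (ST x Sx))).
apply: Ck_on_sum => // i _; apply: Ck_on_scale => //.
  by apply: Ck_on_coord => //; exact: Df.
exact: (IH _ _ ST cf' (Dg _)).
Qed.

End Chain.

(** * Symmetry of second derivatives *)

Section Schwarz.
Context {R : realType} {V : normedModType R}.

Lemma differentiable_id (U : normedModType R) (x : U) : differentiable id x.
Proof. by have [] := is_diff_id x. Qed.

Lemma derive_line (z u : V) (s : R) :
  differentiable (fun t : R => z + t *: u) s /\
  'D_1 (fun t : R => z + t *: u) s = u.
Proof.
have [d D] := deriv_scale (@differentiable_id R s) (differentiable_cst u s).
split; first by apply: differentiableD d; exact: differentiable_cst.
rewrite (_ : (fun t : R => _) = cst z + (fun t : R => id t *: cst u t)) // deriveD.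
- by rewrite derive_cst add0r D derive_id derive_cst scale1r scaler0 addr0.
- exact: derivable_cst.
- exact: diff_derivable.
Qed.

Lemma MVT_line (f : V -> R) (z u : V) (t : R) : 0 < t ->
  (forall s : R, 0 <= s <= t -> differentiable f (z + s *: u)) ->
  exists2 s : R, 0 <= s <= t & f (z + t *: u) - f z = t * 'D_u f (z + s *: u).
Proof.
move=> t0 df.
pose l (s : R) : V := z + s *: u.
have dfl s : 0 <= s <= t -> differentiable (f \o l) s /\ 'D_1 (f \o l) s =
  'D_u f (l s).
  move=> st; have [dl Dl] := derive_line z u s.
  by have [? ->] := derive_comp dl (df s st); split=> //; rewrite Dl.
have [||s sI E] := @MVT R (f \o l) (fun s => 'D_u f (l s)) 0 t t0.
- move=> s; rewrite in_itv /= => /andP[s0 st].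
  have st' : 0 <= s <= t by rewrite !ltW.
  have [d <-] := dfl s st'.
  by apply: derivableP; exact: diff_derivable.
- apply: derivable_within_continuous => s; rewrite in_itv /= => st.
  by apply: diff_derivable; have [] := dfl s st.
exists s; first by move: sI; rewrite in_itv /= => /andP[s0 st]; rewrite !ltW.
by move: E; rewrite /= /l scale0r addr0 subr0 mulrC.
Qed.

Lemma derive_shift_comp (f : V -> R) (w x : V) :
  differentiable f (x + w) -> differentiable (fun y => f (y + w)) x /\
  forall v, 'D_v (fun y => f (y + w)) x = 'D_v f (x + w).
Proof.
move=> df.
have ds : differentiable (fun y : V => y + w) x.
  by apply: differentiableD; [exact: differentiable_id|exact: differentiable_cst].
have [d D] := derive_comp ds df; split=> // v.
rewrite (_ : (fun y => f (y + w)) = f \o (fun y : V => y + w)) // D.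
congr ('D_ _ f _).
rewrite (_ : (fun y => y + w) = id + cst w) // deriveD; last 2 first.
- exact: derivable_id.
- exact: derivable_cst.
by rewrite derive_id derive_cst addr0.
Qed.

(** The mean value theorem is used twice: along [u] for the difference [F] of two translates, then
    along [v] for ['D_u f]. *)
Lemma second_difference (f : V -> R) (S : set V) z u v (t : R) : 0 < t ->
  (forall s s' : R, 0 <= s <= t -> 0 <= s' <= t -> S (z + s *: u + s' *: v)) ->
  Ck_on 2 S f ->
  exists s s' : R, [/\ 0 <= s <= t, 0 <= s' <= t &
    f (z + t *: u + t *: v) - f (z + t *: u) - (f (z + t *: v) - f z)
    = t * (t * 'D_v ('D_u f) (z + s *: u + s' *: v))].
Proof.
move=> t0 inS [df Df].
have tt : 0 <= t <= t by rewrite lexx ltW.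
have t00 : 0 <= (0 : R) <= t by rewrite lexx ltW.
pose F y := f (y + t *: v) - f y.
have dF s : 0 <= s <= t -> differentiable F (z + s *: u) /\
    'D_u F (z + s *: u) = 'D_u f (z + s *: u + t *: v) - 'D_u f (z + s *: u).
  move=> st.
  have d0 : differentiable f (z + s *: u).
    by apply: df; have := inS s 0 st t00; rewrite scale0r addr0.
  have [d1 D1] := derive_shift_comp (df _ (inS s t st tt)).
  split; first exact: differentiableB.
  by rewrite (_ : F = (fun y => f (y + t *: v)) - f) // deriveB ?D1//;
    exact: diff_derivable.
have [s st E] := MVT_line t0 (fun s st => (dF s st).1).
have [|s' st' E'] := @MVT_line ('D_u f) (z + s *: u) v t t0.
  by move=> s' st'; apply: (Df u).1; exact: inS.
by exists s, s'; split=> //; rewrite -E' -(dF s st).2 -E.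
Qed.

(** The second difference is unchanged when [u] and [v] are exchanged, and it is [t ^ 2] times
    either mixed derivative at some point of a small parallelogram. Continuity of both mixed
    derivatives forces equality at [z]. *)
Lemma schwarz_scalar (f : V -> R) (S : set V) z u v : open S -> S z ->
  Ck_on 2 S f -> 'D_u ('D_v f) z = 'D_v ('D_u f) z.
Proof.
move=> oS Sz cf.
apply/eqP; rewrite -subr_eq0 -normr_le0; apply/ler_addgt0Pr => e e0; rewrite add0r.
have cont a b : {for z, continuous (fun y => 'D_a ('D_b f) y)}.
  by have [_ /(_ b)[_ /(_ a) H]] := cf; exact: H.
set a := 'D_u ('D_v f) z; set b := 'D_v ('D_u f) z.
have e2 : 0 < e / 2 by rewrite divr_gt0.
have Nz : \forall y \near z, [/\ S y, `|a - 'D_u ('D_v f) y| < e / 2 &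
    `|b - 'D_v ('D_u f) y| < e / 2].
  have /cvgrPdist_lt/(_ _ e2) H1 := cont u v.
  have /cvgrPdist_lt/(_ _ e2) H2 := cont v u.
  by apply: filterS3 (open_near oS Sz) H1 H2 => y h h1 h2; exact: And3 h h1 h2.
move: Nz => /nbhs_ballP[d /= d0 dN].
(* This size keeps the parallelogram within [d / 2] of [z]; the summand [1] keeps the denominator
   positive even if [u] and [v] vanish. *)
pose t := d / 2 / (`|u| + `|v| + 1).
have k0 : 0 < `|u| + `|v| + 1 by rewrite ltr_wpDl// addr_ge0.
have t0 : 0 < t by rewrite !divr_gt0.
have inB s s' : 0 <= s <= t -> 0 <= s' <= t -> ball z d (z + s *: u + s' *: v).
  move=> /andP[s0 st] /andP[s'0 s't].
  rewrite -ball_normE /= -addrA opprD addNKr normrN.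
  rewrite (le_lt_trans (ler_normD _ _))// !normrZ !ger0_norm//.
  apply: (@le_lt_trans _ _ (t * (`|u| + `|v| + 1))).
    by rewrite !mulrDr -[leLHS]addr0 !lerD ?ler_wpM2r// mulr1 ltW.
  by rewrite /t divfK ?gt_eqF// ltr_pdivrMr// mulr_natr mulr2n ltrDl.
have inB' s s' : 0 <= s <= t -> 0 <= s' <= t -> ball z d (z + s *: v + s' *: u).
  by move=> ss s's; rewrite addrAC; exact: inB.
have [s1 [s1' [h1 h1' E1]]] := second_difference (u := u) (v := v) t0
  (fun s s' h h' => let: And3 x _ _ := dN _ (inB s s' h h') in x) cf.
have [s2 [s2' [h2 h2' E2]]] := second_difference (u := v) (v := u) t0
  (fun s s' h h' => let: And3 x _ _ := dN _ (inB' s s' h h') in x) cf.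
have E : 'D_v ('D_u f) (z + s1 *: u + s1' *: v) =
         'D_u ('D_v f) (z + s2 *: v + s2' *: u).
  apply: (mulfI (lt0r_neq0 t0)); apply: (mulfI (lt0r_neq0 t0)).
  apply: etrans (esym E1) _; apply: etrans _ E2.
  by rewrite [z + t *: v + t *: u]addrAC; ring.
have [_ _ B1] := dN _ (inB _ _ h1 h1').
have [_ B2 _] := dN _ (inB' _ _ h2 h2').
rewrite (_ : a - b = (a - 'D_u ('D_v f) (z + s2 *: v + s2' *: u)) -
  (b - 'D_v ('D_u f) (z + s1 *: u + s1' *: v))); last by rewrite E; ring.
apply: le_trans (ler_normB _ _) _; rewrite [leRHS]splitr.
by apply: lerD; apply: ltW; [exact: B2|exact: B1].
Qed.

Lemma schwarz n (f : V -> 'rV[R]_n) (S : set V) z u v : open S -> S z ->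
  Ck_on 2 S f -> 'D_u ('D_v f) z = 'D_v ('D_u f) z.
Proof.
move=> oS Sz cf; apply/rowP => i.
have [df Df] := cf.
have dd a : differentiable ('D_a f) z by have [d _] := Df a; exact: (d z Sz).
apply: etrans (esym (coord_derive u i (dd v))) _.
apply: etrans _ (coord_derive v i (dd u)).
have E a y : S y -> 'D_a f y 0 i = 'D_a (fun x => f x 0 i) y.
  by move=> Sy; rewrite (coord_derive _ _ (df y Sy)).
have C : Ck_on 2 S (fun x => f x 0 i) by exact: Ck_on_coord.
have N a : \forall y \near z, 'D_a f y 0 i = 'D_a (fun x => f x 0 i) y.
  by apply: filterS (open_near oS Sz) => y; exact: E.
apply: etrans (near_eq_derive _ (N v)) _.
apply: etrans _ (esym (near_eq_derive _ (N u))).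
exact: schwarz_scalar oS Sz C.
Qed.

End Schwarz.

Section SmoothOn.
Context {R : realType} {V W : normedModType R}.
Implicit Types (S : set V).

Lemma smooth_on_sub S (T : set V) (f : V -> W) :
  T `<=` S -> smooth_on S f -> smooth_on T f.
Proof. by move=> TS sf k; exact: Ck_on_sub TS (sf k). Qed.

Lemma smooth_on_eq S (f g : V -> W) : open S ->
  (forall x, S x -> f x = g x) -> smooth_on S f -> smooth_on S g.
Proof. by move=> oS fg sf k; exact: Ck_on_eq oS fg (sf k). Qed.

Lemma smooth_on_cst S (w : W) : smooth_on S (fun=> w).
Proof. by move=> k; exact: Ck_on_cst. Qed.

Lemma smooth_onD S (f g : V -> W) : open S ->
  smooth_on S f -> smooth_on S g -> smooth_on S (fun x => f x + g x).
Proof. by move=> oS sf sg k; exact: Ck_onD oS (sf k) (sg k). Qed.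

Lemma smooth_on_scale S (f : V -> R) (g : V -> W) : open S ->
  smooth_on S f -> smooth_on S g -> smooth_on S (fun x => f x *: g x).
Proof. by move=> oS sf sg k; exact: Ck_on_scale oS (sf k) (sg k). Qed.

Lemma smooth_onN S (f : V -> W) : open S ->
  smooth_on S f -> smooth_on S (fun x => - f x).
Proof.
move=> oS sf; have := smooth_on_scale oS (fun k => Ck_on_cst k S (-1 : R)) sf.
by apply: smooth_on_eq => // x _; rewrite scaleN1r.
Qed.

Lemma smooth_onB S (f g : V -> W) : open S ->
  smooth_on S f -> smooth_on S g -> smooth_on S (fun x => f x - g x).
Proof. by move=> oS sf sg; apply: smooth_onD oS sf (smooth_onN oS sg). Qed.

Lemma smooth_on_sum S I (r : seq I) (P : pred I) (f : I -> V -> W) : open S ->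
  (forall i, P i -> smooth_on S (f i)) ->
  smooth_on S (fun x => \sum_(i <- r | P i) f i x).
Proof. by move=> oS sf k; apply: Ck_on_sum oS _ => i Pi; exact: sf. Qed.

Lemma smooth_on_differentiable S (f : V -> W) x :
  smooth_on S f -> S x -> differentiable f x.
Proof. by move=> /(_ 1%N) [df _] Sx; exact: df. Qed.

(** Bridge between the ['D_v f] of [Ck_on] and the differential, whose linearity in [v] the
    geometric computations rely on. *)
Lemma smooth_on_diff S (f : V -> W) v : open S ->
  smooth_on S f -> smooth_on S (fun x => 'd f x v).
Proof.
move=> oS sf k; have [df /(_ v)] := sf k.+1.
by apply: Ck_on_eq => // x Sx; rewrite deriveE//; exact: df.
Qed.

Lemma diff_eq_on S (f g : V -> W) x v : open S -> S x ->
  (forall y, S y -> f y = g y) -> differentiable f x -> 'd f x v = 'd g x v.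
Proof.
move=> oS Sx fg df.
have fgn : \near x, f x = g x by apply: filterS (open_near oS Sx) => y /fg.
rewrite -!deriveE//; first exact: near_eq_derive.
exact: near_eq_differentiable df.
Qed.

Lemma diffDE (f g : V -> W) x v : differentiable f x -> differentiable g x ->
  'd (fun y => f y + g y) x v = 'd f x v + 'd g x v.
Proof. by move=> df dg; rewrite (diffD df dg). Qed.

Lemma diffZE (c : R) (f : V -> W) x v : differentiable f x ->
  'd (fun y => c *: f y) x v = c *: 'd f x v.
Proof. by move=> df; rewrite (diffZ c df). Qed.

Lemma diff_cstE (w : W) x v : 'd (fun _ : V => w) x v = 0.
Proof. by rewrite (diff_cst w x). Qed.

Lemma diff_app n (B : V -> 'rV[R]_n -> W) (Y : V -> 'rV[R]_n) z u :
  (forall z, linear (B z)) -> differentiable Y z ->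
  (forall w, differentiable (B ^~ w) z) ->
  'd (fun z => B z (Y z)) z u = 'd (B ^~ (Y z)) z u + B z ('d Y z u).
Proof.
move=> lB dY dB; have [d D] := deriv_app lB dY dB.
by rewrite -!deriveE.
Qed.

Lemma smooth_on_app n S (B : V -> 'rV[R]_n -> W) (Y : V -> 'rV[R]_n) :
  (forall z, linear (B z)) -> open S -> smooth_on S Y ->
  (forall w, smooth_on S (B ^~ w)) -> smooth_on S (fun z => B z (Y z)).
Proof. by move=> lB oS sY sB k;
  exact: (Ck_on_app lB oS (sY k) (fun w => sB w k)). Qed.

Lemma diff_chain (U : normedModType R) (f : V -> U) (g : U -> W) x v :
  differentiable f x -> differentiable g (f x) ->
  'd (fun y => g (f y)) x v = 'd g (f x) ('d f x v).
Proof. by move=> df dg; rewrite (diff_comp df dg). Qed.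

Lemma smooth_on_comp n S (T : set 'rV[R]_n) (f : V -> 'rV[R]_n)
    (g : 'rV[R]_n -> W) : open S -> open T -> (forall x, S x -> T (f x)) ->
  smooth_on S f -> smooth_on T g -> smooth_on S (fun x => g (f x)).
Proof. by move=> oS oT ST sf sg k; exact: Ck_on_comp oS oT ST (sf k) (sg k). Qed.

End SmoothOn.

Lemma smooth_on_diff_app (R : realType) (W : normedModType R) n
    (S : set 'rV[R]_n) (f : 'rV[R]_n -> W) (X : 'rV[R]_n -> 'rV[R]_n) :
  open S -> smooth_on S f -> smooth_on S X -> smooth_on S (fun x => 'd f x (X x)).
Proof.
move=> oS sf sX; apply: (smooth_on_app (B := fun x u => 'd f x u)) => //.
  by move=> z; exact: linearP.
by move=> w; exact: smooth_on_diff.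
Qed.

Lemma diff_idE (R : realType) (V : normedModType R) (x v : V) : 'd id x v = v.
Proof. by rewrite -deriveE ?derive_id//; exact: differentiable_id. Qed.

Lemma diff_sym (R : realType) (V : normedModType R) n (S : set V)
  (f : V -> 'rV[R]_n) x u v :
  open S -> S x -> smooth_on S f ->
  'd (fun y => 'd f y v) x u = 'd (fun y => 'd f y u) x v.
Proof.
move=> oS Sx sf.
have dD a : differentiable ('D_a f) x.
  have [_ Df] := sf 2%N; have [d _] := Df a; exact: (d x Sx).
have key a b : 'd (fun y => 'd f y a) x b = 'D_b ('D_a f) x.
  rewrite deriveE; last exact: dD.
  apply: (diff_eq_on _ oS Sx).
    by move=> y Sy; rewrite deriveE//; exact: smooth_on_differentiable sf Sy.
  exact: smooth_on_differentiable (smooth_on_diff a oS sf) Sx.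
apply: etrans (key v u) _; apply: etrans _ (esym (key u v)).
exact: schwarz oS Sx (sf 2%N).
Qed.

Lemma diff_diff (R : realType) (W : normedModType R) n (S : set 'rV[R]_n)
    (f : 'rV[R]_n -> W) (Y : 'rV[R]_n -> 'rV[R]_n) z u : open S -> S z ->
  smooth_on S f -> smooth_on S Y ->
  'd (fun q => 'd f q (Y q)) z u =
    'd (fun q => 'd f q (Y z)) z u + 'd f z ('d Y z u).
Proof.
move=> oS Sz sf sY.
exact: (diff_app (B := fun q v => 'd f q v) (Y := Y) u (fun q => linearP ('d f q))
  (smooth_on_differentiable sY Sz)
  (fun w => smooth_on_differentiable (smooth_on_diff w oS sf) Sz)).
Qed.

(** * Smoothness of quotients, determinants and inverse matrices *)

Section SmoothMatrices.
Context {R : realType} {V : normedModType R}.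
Implicit Types (S : set V) (f g : V -> R).

Lemma smooth_onM S f g : open S -> smooth_on S f -> smooth_on S g ->
  smooth_on S (fun x => f x * g x).
Proof. by move=> oS sf sg; apply: smooth_on_eq (smooth_on_scale oS sf sg). Qed.

Lemma smooth_on_prod S I (r : seq I) (f : I -> V -> R) : open S ->
  (forall i, smooth_on S (f i)) -> smooth_on S (fun x => \prod_(i <- r) f i x).
Proof.
move=> oS sf; elim: r => [|i r IH].
  by apply: smooth_on_eq (fun k => Ck_on_cst k S (1 : R)) => // x _;
    rewrite big_nil.
apply: smooth_on_eq (smooth_onM oS (sf i) IH) => // x _.
by rewrite big_cons.
Qed.

Lemma Ck_onV k S f : open S -> (forall x, S x -> f x != 0) ->
  Ck_on k S f -> Ck_on k S (fun x => (f x)^-1).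
Proof.
move=> oS f0; elim: k f f0 => [|k IH] f f0.
  by move=> /= cf x Sx; apply: cvgV; [exact: f0|exact: cf].
move=> cf; have cV := IH f f0 (Ck_on_pred cf).
case: cf => df Df; split=> [x Sx|v].
  by apply: differentiableV; [exact: df|exact: f0].
have cV2 := Ck_on_scale oS cV cV.
apply: Ck_on_eq (Ck_on_scale oS (Ck_on_scale oS (Ck_on_cst k S (-1 : R)) cV2)
  (Df v)) => //.
move=> x Sx; have e := deriveV (f0 x Sx) (diff_derivable (v := v) (df x Sx)).
apply: etrans _ (esym e).
by congr (_ *: _); rewrite -[LHS]/(-1 * ((f x)^-1 * (f x)^-1)) mulN1r -expr2 exprVn.
Qed.

Lemma smooth_onV S f : open S -> (forall x, S x -> f x != 0) ->
  smooth_on S f -> smooth_on S (fun x => (f x)^-1).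
Proof. by move=> oS f0 sf k; exact: Ck_onV (sf k). Qed.

Lemma smooth_on_det S n (A : V -> 'M[R]_n) : open S ->
  (forall i j, smooth_on S (fun x => A x i j)) -> smooth_on S (fun x => \det (A x)).
Proof.
move=> oS sA; apply: smooth_on_sum => // s _; apply: smooth_onM => //.
  exact: smooth_on_cst.
exact: smooth_on_prod.
Qed.

(** Cramer's rule: the entries are cofactors divided by the determinant. *)
Lemma smooth_on_invmx S n (A : V -> 'M[R]_n) i j : open S ->
  (forall x, S x -> A x \in unitmx) ->
  (forall i j, smooth_on S (fun x => A x i j)) ->
  smooth_on S (fun x => invmx (A x) i j).
Proof.
move=> oS uA sA.
have s1 : smooth_on S (fun x => (\det (A x))^-1).
  apply: smooth_onV => //; last exact: smooth_on_det.
  by move=> x Sx; have := uA x Sx; rewrite unitmxE unitfE.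
have s2 : smooth_on S (fun x => (-1) ^+ (j + i) * \det (row' j (col' i (A x)))).
  apply: smooth_onM => //; first exact: smooth_on_cst.
  apply: smooth_on_det => // k l;
    apply: smooth_on_eq (sA (lift j k) (lift i l)) => // x _.
  by rewrite !mxE.
apply: smooth_on_eq (smooth_onM oS s1 s2) => // x Sx.
by rewrite /invmx uA// !mxE.
Qed.

End SmoothMatrices.

(** * Metrics and connections on an open set of coordinates *)

(** Linearity in the vectors is asked at every [z], even outside [S], because [diff_app] takes a
    family of linear maps on the whole space. The last field is metric compatibility tested on
    constant fields. *)
Record local_levi_civita (R : realType) n (S : set 'rV[R]_n)
    (G : 'rV[R]_n -> 'rV[R]_n -> 'rV[R]_n -> R)
    (C : 'rV[R]_n -> 'rV[R]_n -> 'rV[R]_n -> 'rV[R]_n) : Prop := {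
  local_open : open S ;
  local_metric_linear : forall z u, linear (G z u) ;
  local_metric_sym : forall z u v, G z u v = G z v u ;
  local_metric_pos : forall z u, S z -> u != 0 -> 0 < G z u u ;
  local_metric_smooth : forall u v, smooth_on S (fun z => G z u v) ;
  christoffel_linear : forall z u, linear (C z u) ;
  christoffel_linearl : forall z v, linear (fun u => C z u v) ;
  christoffel_sym : forall z u v, S z -> C z u v = C z v u ;
  christoffel_smooth : forall u v, smooth_on S (fun z => C z u v) ;
  christoffel_metric : forall z u v w, S z ->
    'd (fun y => G y v w) z u = G z (C z u v) w + G z v (C z u w) }.

Section LocalConnection.
Context {R : realType} {n : nat}.
Variables (S : set 'rV[R]_n) (G : 'rV[R]_n -> 'rV[R]_n -> 'rV[R]_n -> R).
Variable (C : 'rV[R]_n -> 'rV[R]_n -> 'rV[R]_n -> 'rV[R]_n).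
Hypothesis lc : local_levi_civita S G C.
Implicit Types (X Y Z : 'rV[R]_n -> 'rV[R]_n) (u v w x y z : 'rV[R]_n).

Let oS : open S := local_open lc.

Definition local_cov u Y z := 'd Y z u + C z u (Y z).

Definition local_bracket X Y z := 'd Y z (X z) - 'd X z (Y z).

(* The sign convention is that of [curvature_field]; on constant fields the
   bracket term vanishes. *)
Definition local_curvature z x y w :=
  - ('d (fun q => C q y w) z x + C z x (C z y w))
  + ('d (fun q => C q x w) z y + C z y (C z x w)).

Lemma local_metricDr z u v w : G z u (v + w) = G z u v + G z u w.
Proof. exact: (linear_funD (local_metric_linear lc z u)). Qed.

Lemma local_metricZr z a u v : G z u (a *: v) = a * G z u v.
Proof. exact: (linear_funZ (local_metric_linear lc z u)). Qed.

Lemma local_metricDl z u v w : G z (u + v) w = G z u w + G z v w.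
Proof. by rewrite !(local_metric_sym lc _ _ w) local_metricDr. Qed.

Lemma local_metricZl z a u v : G z (a *: u) v = a * G z u v.
Proof. by rewrite !(local_metric_sym lc _ _ v) local_metricZr. Qed.

Lemma local_metricNr z u v : G z u (- v) = - G z u v.
Proof. by rewrite -scaleN1r local_metricZr mulN1r. Qed.

Lemma local_metricNl z u v : G z (- u) v = - G z u v.
Proof. by rewrite -scaleN1r local_metricZl mulN1r. Qed.

Lemma local_metric0r z u : G z u 0 = 0.
Proof. by rewrite -(scale0r 0) local_metricZr mul0r. Qed.

Lemma local_metric_linearl z v : linear (fun u => G z u v).
Proof. by move=> a u w; rewrite local_metricDl local_metricZl. Qed.

Lemma local_metric_eq0 z u : S z -> G z u u = 0 -> u = 0.
Proof.
move=> Sz Gu; apply/eqP; apply: contraT => u0.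
by have := local_metric_pos lc Sz u0; rewrite Gu ltxx.
Qed.

Lemma local_metric_inj z u v : S z -> (forall w, G z u w = G z v w) -> u = v.
Proof.
move=> Sz Guv; apply/eqP; rewrite -subr_eq0; apply/eqP.
apply: (local_metric_eq0 Sz).
by rewrite local_metricDl local_metricNl Guv subrr.
Qed.

Lemma smooth_on_metric Y Z : smooth_on S Y -> smooth_on S Z ->
  smooth_on S (fun q => G q (Y q) (Z q)).
Proof.
move=> sY sZ; apply: (smooth_on_app (B := fun q => G q (Y q))) => //.
  by move=> q; exact: (local_metric_linear lc).
move=> w; apply: (smooth_on_app (B := fun q u => G q u w)) => //.
  by move=> q; exact: local_metric_linearl.
by move=> v; exact: (local_metric_smooth lc).
Qed.

Lemma smooth_on_christoffel Y Z : smooth_on S Y -> smooth_on S Z ->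
  smooth_on S (fun q => C q (Y q) (Z q)).
Proof.
move=> sY sZ; apply: (smooth_on_app (B := fun q => C q (Y q))) => //.
  by move=> q; exact: (christoffel_linear lc).
move=> w; apply: (smooth_on_app (B := fun q u => C q u w)) => //.
  by move=> q; exact: (christoffel_linearl lc).
by move=> v; exact: (christoffel_smooth lc).
Qed.

Lemma smooth_on_cov X Y : smooth_on S X -> smooth_on S Y ->
  smooth_on S (fun q => local_cov (X q) Y q).
Proof.
move=> sX sY; apply: smooth_onD => //; first exact: smooth_on_diff_app.
exact: smooth_on_christoffel.
Qed.

Lemma smooth_on_bracket X Y : smooth_on S X -> smooth_on S Y ->
  smooth_on S (local_bracket X Y).
Proof. by move=> sX sY; apply: smooth_onB => //; exact: smooth_on_diff_app. Qed.

(** Freezing first [Z] and then [Y] leaves the derivative of the metric on constant vectors, given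
    by [christoffel_metric]; its two Christoffel terms complete the covariant derivatives. *)
Lemma diff_metric Y Z z u : S z -> smooth_on S Y -> smooth_on S Z ->
  'd (fun q => G q (Y q) (Z q)) z u =
  G z (local_cov u Y z) (Z z) + G z (Y z) (local_cov u Z z).
Proof.
move=> Sz sY sZ; have dY := smooth_on_differentiable sY Sz.
have dZ := smooth_on_differentiable sZ Sz.
have sc w : smooth_on S (fun=> w) by exact: smooth_on_cst.
have E1 := diff_app (B := fun q => G q (Y q)) (Y := Z) (z := z) u
  (fun q => local_metric_linear lc q (Y q)) dZ
  (fun w => smooth_on_differentiable (smooth_on_metric sY (sc w)) Sz).
have E2 := diff_app (B := fun q v => G q v (Z z)) (Y := Y) (z := z) u
  (fun q => local_metric_linearl q (Z z)) dY
  (fun w => smooth_on_differentiable (smooth_on_metric (sc w) (sc (Z z))) Sz).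
have E3 := christoffel_metric lc u (Y z) (Z z) Sz.
apply: etrans E1 _.
apply: etrans (congr1 (+%R^~ _) (etrans E2 (congr1 (+%R^~ _) E3))) _.
by rewrite /local_cov local_metricDl local_metricDr; ring.
Qed.

Lemma diff_christoffel Y Z z u : S z -> smooth_on S Y -> smooth_on S Z ->
  'd (fun q => C q (Y q) (Z q)) z u =
  'd (fun q => C q (Y z) (Z z)) z u + C z ('d Y z u) (Z z) + C z (Y z) ('d Z z u).
Proof.
move=> Sz sY sZ; have dY := smooth_on_differentiable sY Sz.
have dZ := smooth_on_differentiable sZ Sz.
have sc w : smooth_on S (fun=> w) by exact: smooth_on_cst.
have E1 := diff_app (B := fun q => C q (Y q)) (Y := Z) (z := z) u
  (fun q => christoffel_linear lc q (Y q)) dZ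
  (fun w => smooth_on_differentiable (smooth_on_christoffel sY (sc w)) Sz).
have E2 := diff_app (B := fun q v => C q v (Z z)) (Y := Y) (z := z) u
  (fun q => christoffel_linearl lc q (Z z)) dY
  (fun w => smooth_on_differentiable (christoffel_smooth lc w (Z z)) Sz).
exact: etrans E1 (congr1 (+%R^~ _) E2).
Qed.

Lemma local_covB z u v Y : local_cov (u - v) Y z =
  local_cov u Y z - local_cov v Y z.
Proof.
rewrite /local_cov linearB (linear_funB (christoffel_linearl lc z (Y z))).
by rewrite opprD addrACA.
Qed.

Lemma local_covDl z u v Y : local_cov (u + v) Y z =
  local_cov u Y z + local_cov v Y z.
Proof.
rewrite /local_cov linearD (linear_funD (christoffel_linearl lc z (Y z))).
by rewrite addrACA.
Qed.

Lemma local_covDr z u Y Y' : differentiable Y z -> differentiable Y' z ->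
  local_cov u (fun q => Y q + Y' q) z = local_cov u Y z + local_cov u Y' z.
Proof.
move=> dY dY'; have e1 := diffDE u dY dY'.
have e2 := linear_funD (christoffel_linear lc z u) (Y z) (Y' z).
by apply: etrans (congr2 +%R e1 e2) _; exact: addrACA.
Qed.

Lemma local_torsion_free X Y z : S z ->
  local_cov (X z) Y z - local_cov (Y z) X z = local_bracket X Y z.
Proof.
move=> Sz; rewrite /local_cov /local_bracket (christoffel_sym lc (X z))//.
by rewrite opprD addrACA subrr addr0.
Qed.

(** The left side is the curvature operator in the opposite sign convention, hence the minus sign.
    For non-constant fields this is the tensoriality of curvature. *)
Lemma local_ricci X Y Z z : S z -> smooth_on S X -> smooth_on S Y ->
  smooth_on S Z ->
  local_cov (X z) (fun q => local_cov (Y q) Z q) z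
  - local_cov (Y z) (fun q => local_cov (X q) Z q) z
  - local_cov (local_bracket X Y z) Z z
  = - local_curvature z (X z) (Y z) (Z z).
Proof.
move=> Sz sX sY sZ.
(* The last summand isolates the derivative of [B]; antisymmetrization turns it into the covariant
   derivative along the bracket. *)
have key A B : smooth_on S A -> smooth_on S B ->
  local_cov (A z) (fun q => local_cov (B q) Z q) z =
  'd (fun q => 'd Z q (B z)) z (A z) + C z (B z) ('d Z z (A z)) +
    C z (A z) ('d Z z (B z))
  + ('d (fun q => C q (B z) (Z z)) z (A z) + C z (A z) (C z (B z) (Z z)))
  + local_cov ('d B z (A z)) Z z.
  move=> sA sB.
  have E1 := diffDE (A z)
    (smooth_on_differentiable (smooth_on_diff_app oS sZ sB) Sz)
    (smooth_on_differentiable (smooth_on_christoffel sB sZ) Sz).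
  have E2 := diff_diff (A z) oS Sz sZ sB.
  have E3 := diff_christoffel (A z) Sz sB sZ.
  apply: etrans (congr1 (+%R^~ _) (etrans E1 (congr2 +%R E2 E3))) _.
  rewrite /local_cov (linear_funD (christoffel_linear lc z (A z))).
  have ac (a b c d e f g : 'rV[R]_n) :
    a + b + (c + d + e) + (f + g) = a + e + f + (c + g) + (b + d).
    by apply/rowP => i; rewrite !mxE; ring.
  exact: ac.
have k1 := key _ _ sX sY; have k2 := key _ _ sY sX.
apply: etrans (congr2 (fun a b => a - b - _) k1 k2) _.
(* The second derivatives of [Z] are the only terms that do not match algebraically. *)
have E4 := diff_sym (X z) (Y z) oS Sz sZ.
apply: etrans (congr1 (fun a => a + _ + _ + _ + _ - _ - _) E4) _.
have E5 := local_covB z ('d Y z (X z)) ('d X z (Y z)) Z.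
apply: etrans (congr1 (fun a => _ - a) E5) _.
have ac (a b c d d' e f : 'rV[R]_n) :
  a + b + c + d + e - (a + c + b + d' + f) - (e - f) = - (- d + d').
  by apply/rowP => i; rewrite !mxE; ring.
exact: ac.
Qed.

End LocalConnection.

Lemma local_levi_civita_sub (R : realType) n (S S' : set 'rV[R]_n) G C :
  open S' -> S' `<=` S -> local_levi_civita S G C -> local_levi_civita S' G C.
Proof.
move=> oS' SS' [oS Gl Gs Gp Gsm Cl Cl' Cs Csm Cm]; split=> //.
- by move=> z u /SS'; exact: Gp.
- by move=> u v; exact: smooth_on_sub SS' (Gsm u v).
- by move=> z u v /SS'; exact: Cs.
- by move=> u v; exact: smooth_on_sub SS' (Csm u v).
- by move=> z u v w /SS'; exact: Cm.
Qed.

(** * O'Neill's formula in coordinates *)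

(** [L z w] is the horizontal lift of [w]. The single equation [lift_metric] encodes both properties
    of it: for [u] in the kernel of ['d F z] it says that lifts are orthogonal to the fibres, and
    for [u] a lift that ['d F z] is isometric on them. *)
Record local_submersion (R : realType) n k (S : set 'rV[R]_n) (T : set 'rV[R]_k)
    (G : 'rV[R]_n -> 'rV[R]_n -> 'rV[R]_n -> R)
    (H : 'rV[R]_k -> 'rV[R]_k -> 'rV[R]_k -> R)
    (F : 'rV[R]_n -> 'rV[R]_k) (L : 'rV[R]_n -> 'rV[R]_k -> 'rV[R]_n) : Prop := {
  submersion_maps : forall z, S z -> T (F z) ;
  submersion_smooth_on : smooth_on S F ;
  lift_linear : forall z, linear (L z) ;
  lift_smooth : forall w, smooth_on S (fun z => L z w) ;
  lift_section : forall z w, S z -> 'd F z (L z w) = w ;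
  lift_metric : forall z w u, S z -> G z (L z w) u = H (F z) w ('d F z u) }.

Section ONeill.
Context {R : realType} {n k : nat}.
Variables (S : set 'rV[R]_n) (T : set 'rV[R]_k).
Variables (G : 'rV[R]_n -> 'rV[R]_n -> 'rV[R]_n -> R).
Variables (C : 'rV[R]_n -> 'rV[R]_n -> 'rV[R]_n -> 'rV[R]_n).
Variables (H : 'rV[R]_k -> 'rV[R]_k -> 'rV[R]_k -> R).
Variables (D : 'rV[R]_k -> 'rV[R]_k -> 'rV[R]_k -> 'rV[R]_k).
Variables (F : 'rV[R]_n -> 'rV[R]_k) (L : 'rV[R]_n -> 'rV[R]_k -> 'rV[R]_n).
Hypotheses (lc : local_levi_civita S G C) (lc' : local_levi_civita T H D).
Hypothesis sub : local_submersion S T G H F L.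

Let oS : open S := local_open lc.
Let E w := fun z => L z w.
Let sE w : smooth_on S (E w) := lift_smooth sub w.

(** Differentiating the constant ['d F q (X q)] expresses ['d F] of a derivative of [X] by the
    Hessian of [F]; the two Hessian terms cancel by symmetry. The cases [x = 0] and [y = 0] cover
    vertical fields. *)
Lemma bracket_vertical X Y x y z : S z -> smooth_on S X -> smooth_on S Y ->
  (forall q, S q -> 'd F q (X q) = x) -> (forall q, S q -> 'd F q (Y q) = y) ->
  'd F z (local_bracket X Y z) = 0.
Proof.
move=> Sz sX sY FX FY; have sF := submersion_smooth_on sub.
have key A c u : smooth_on S A -> (forall q, S q -> 'd F q (A q) = c) ->
    'd F z ('d A z u) = - 'd (fun q => 'd F q (A z)) z u.
  move=> sA FA; apply/eqP; rewrite -addr_eq0 addrC; apply/eqP.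
  have E1 := diff_diff u oS Sz sF sA.
  apply: etrans (esym E1) _.
  have E2 := diff_eq_on u oS Sz FA
    (smooth_on_differentiable (smooth_on_diff_app oS sF sA) Sz).
  by apply: etrans E2 _; exact: diff_cstE.
rewrite /local_bracket linearB /=.
apply: etrans (congr2 (fun a b => a - b) (key _ _ (X z) sY FY)
  (key _ _ (Y z) sX FX)) _.
apply: etrans (congr1 (fun a => - a - _) (diff_sym (X z) (Y z) oS Sz sF)) _.
by rewrite opprK addNr.
Qed.

Lemma lift_bracket_vertical x y z : S z -> 'd F z (local_bracket (E x) (E y) z) = 0.
Proof.
move=> Sz; apply: (bracket_vertical (x := x) (y := y) Sz (sE x) (sE y)).
  by move=> q Sq; exact: (lift_section sub).
by move=> q Sq; exact: (lift_section sub).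
Qed.

Lemma metric_lift_vertical x z v : S z -> 'd F z v = 0 -> G z (E x z) v = 0.
Proof. by move=> Sz Fv; rewrite (lift_metric sub)// Fv (local_metric0r lc'). Qed.

Lemma metric_lift2 x y z : S z -> G z (E x z) (E y z) = H (F z) x y.
Proof. by move=> Sz; rewrite (lift_metric sub)// (lift_section sub). Qed.

Lemma diff_metric_lift x y z u : S z ->
  'd (fun q => G q (E x q) (E y q)) z u = 'd (fun q => H q x y) (F z) ('d F z u).
Proof.
move=> Sz.
have E1 := diff_eq_on u oS Sz (fun q => @metric_lift2 x y q)
  (smooth_on_differentiable (smooth_on_metric lc (sE x) (sE y)) Sz).
apply: etrans E1 _.
apply: (diff_chain u (g := fun q => H q x y)).
  exact: smooth_on_differentiable (submersion_smooth_on sub) Sz.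
exact: smooth_on_differentiable (local_metric_smooth lc' x y)
  (submersion_maps sub Sz).
Qed.

Lemma lift_cov_horizontal x y z : S z ->
  'd F z (local_cov C (E x z) (E y) z) = D (F z) x y.
Proof.
move=> Sz; have TF := submersion_maps sub Sz.
(* [b] is symmetric in its first two arguments and antisymmetric in the last
   two, hence zero. *)
pose b x y w := H (F z) w ('d F z (local_cov C (E x z) (E y) z)) -
  H (F z) w (D (F z) x y).
(* Symmetry holds because both connections are torsion-free and the bracket of two lifts is
   vertical; antisymmetry, next, because both are metric and inner products of lifts are functions
   on the base. *)
have bs x' y' w : b x' y' w = b y' x' w.
  apply/eqP; rewrite /b -subr_eq0 (christoffel_sym lc' y')//.
  have := lift_bracket_vertical x' y' Sz.
  rewrite -(local_torsion_free lc)// linearB /= => /subr0_eq ->.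
  by rewrite subrr.
have ba x' y' w : b x' y' w = - b x' w y'.
  have := diff_metric lc (E x' z) Sz (sE y') (sE w).
  rewrite (diff_metric_lift _ _ _ Sz) (lift_section sub)//
    (christoffel_metric lc')//.
  rewrite (local_metric_sym lc _ (local_cov _ _ _ _)) !(lift_metric sub)// /b.
  by rewrite (local_metric_sym lc' _ (D _ _ _) w) => e; lra.
have b0 x' y' w : b x' y' w = 0.
  (* Alternating the two symmetries runs through the six permutations of the arguments and returns
     to the start with the opposite sign. *)
  have := (ba x' y' w, bs x' w y', ba w x' y', bs w y' x', ba y' w x', bs y' x' w).
  by move=> [[[[[h1 h2] h3] h4] h5] h6]; clear -h1 h2 h3 h4 h5 h6; lra.
apply: (local_metric_inj lc' TF) => w.
by apply/eqP; rewrite !(local_metric_sym lc' _ _ w) -subr_eq0 -/(b x y w) b0.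
Qed.

(* A vertical vector [v] extends to the vertical field [V := v - L (dF v)]. With
   [X := E x] one has [G (nabla_X X) V = - G X (nabla_V X) = - V |X|^2 / 2 = 0],
   because [|X|^2] is constant along the fibres. *)
Lemma lift_cov_diag x z : S z ->
  local_cov C (E x z) (E x) z = E (D (F z) x x) z.
Proof.
move=> Sz; have sF := submersion_smooth_on sub.
have vert v : 'd F z v = 0 -> G z (local_cov C (E x z) (E x) z) v = 0.
  move=> Fv.
  pose V q := v - L q ('d F q v).
  have sV : smooth_on S V.
    apply: smooth_onB => //; first exact: smooth_on_cst.
    exact: (smooth_on_app (B := L) (lift_linear sub) oS (smooth_on_diff v oS sF)
      (lift_smooth sub)).
  have Vz : V z = v by rewrite /V Fv (linear_fun0 (lift_linear sub z)) subr0.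
  have FV q : S q -> 'd F q (V q) = 0.
    by move=> Sq; rewrite linearB /= (lift_section sub)// subrr.
  have GV q : S q -> G q (E x q) (V q) = 0.
    by move=> Sq; apply: metric_lift_vertical => //; exact: FV.
  have e1 := diff_metric lc (E x z) Sz (sE x) sV.
  have e2 := diff_eq_on (E x z) oS Sz GV
    (smooth_on_differentiable (smooth_on_metric lc (sE x) sV) Sz).
  have {e2}e1 := etrans (esym e1) (etrans e2 (diff_cstE _ _ _)).
  have e3 := diff_metric lc v Sz (sE x) (sE x).
  have {}e3 := etrans (esym e3) (diff_metric_lift x x v Sz).
  rewrite Fv linear0 in e3.
  have e4 := local_torsion_free lc (E x) V Sz.
  (* This exchanges [nabla_X V] for [nabla_V X]: [V] projects to the zero field, so its bracket with
     [E x] is vertical. *)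
  have e5 : G z (E x z) (local_bracket (E x) V z) = 0.
    apply: metric_lift_vertical => //.
    apply: (bracket_vertical (x := x) (y := 0) Sz (sE x) sV) => // q Sq.
    exact: (lift_section sub).
  rewrite -e4 (local_metricDr lc) (local_metricNr lc) Vz in e5.
  rewrite Vz in e1; rewrite (local_metric_sym lc _ _ (E x z)) in e3.
  lra.
(* The difference of the two sides is vertical, and both sides are orthogonal to vertical vectors,
   so it is orthogonal to itself. *)
apply/eqP; rewrite -subr_eq0; apply/eqP; apply: (local_metric_eq0 lc Sz).
set u := _ - _.
have Fu : 'd F z u = 0.
  by rewrite linearB /= lift_cov_horizontal// (lift_section sub)// subrr.
by rewrite {1}/u (local_metricDl lc)
  (local_metricNl lc) vert// metric_lift_vertical// subrr.
Qed.

(** Polarization of [lift_cov_diag] gives the sum with [x] and [y] exchanged, torsion-freeness the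
    difference; the half comes from solving for one term. *)
Lemma lift_covE x y z : S z -> local_cov C (E x z) (E y) z =
  E (D (F z) x y) z + 2^-1 *: local_bracket (E x) (E y) z.
Proof.
move=> Sz; have lL := lift_linear sub.
have dE w := smooth_on_differentiable (sE w) Sz.
have e1 : local_cov C (E (x + y) z) (E (x + y)) z =
   local_cov C (E x z) (E x) z + local_cov C (E x z) (E y) z +
   (local_cov C (E y z) (E x) z + local_cov C (E y z) (E y) z).
  rewrite (_ : E (x + y) = fun q => E x q + E y q); last first.
    by apply/funext => q; rewrite /E (linear_funD (lL q)).
  by rewrite (local_covDr lc _ (dE x) (dE y)) !(local_covDl lc) addrACA addrA
    addrAC -!addrA.
have TF := submersion_maps sub Sz.
have Dl a b := linear_funD (christoffel_linear lc' (F z) a) b.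
have Dr w := linear_funD (christoffel_linearl lc' (F z) w).
have e2 := local_torsion_free lc (E x) (E y) Sz.
move: e1; rewrite !lift_cov_diag// Dr !Dl /E !(linear_funD (lL z)).
rewrite (christoffel_sym lc' y)// -/(E x) -/(E y) => e1.
apply/rowP => i; move/rowP/(_ i) : e1; move/rowP/(_ i) : e2; rewrite !mxE.
move=> e2 e1; lra.
Qed.

Lemma local_bracketC (X Y : 'rV[R]_n -> 'rV[R]_n) z : local_bracket X Y z =
  - local_bracket Y X z.
Proof. by rewrite /local_bracket opprB. Qed.

(** Lifts are orthogonal to the vertical brackets, so no cross terms remain; [4^-1] is the product
    of two halves. *)
Lemma metric_lift_cov2 a b u w z : S z ->
  G z (local_cov C (E a z) (E b) z) (local_cov C (E u z) (E w) z) =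
  H (F z) (D (F z) a b) (D (F z) u w) +
  4^-1 * G z (local_bracket (E a) (E b) z) (local_bracket (E u) (E w) z).
Proof.
move=> Sz.
have gen p q B B' : 'd F z B = 0 -> 'd F z B' = 0 ->
    G z (E p z + 2^-1 *: B) (E q z + 2^-1 *: B') = H (F z) p q + 4^-1 * G z B B'.
  move=> FB FB'; rewrite (local_metricDl lc) !(local_metricDr lc) metric_lift2//.
  rewrite !(local_metricZl lc) !(local_metricZr lc)
    (local_metric_sym lc _ B (E _ _)).
  by rewrite !metric_lift_vertical//; field.
by rewrite !lift_covE//; apply: gen; exact: lift_bracket_vertical.
Qed.

(** The inner product of [nabla_(E a) (E b)] with [E w] is a function on the base. Differentiating
    it along [E u] upstairs and downstairs and comparing leaves the bracket term of
    [metric_lift_cov2]. *)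
Lemma metric_lift_cov_cov a b u w z : S z ->
  G z (local_cov C (E u z) (fun q => local_cov C (E a q) (E b) q) z) (E w z) =
  H (F z) ('d (fun r => D r a b) (F z) u + D (F z) u (D (F z) a b)) w -
  4^-1 * G z (local_bracket (E a) (E b) z) (local_bracket (E u) (E w) z).
Proof.
move=> Sz; have TF := submersion_maps sub Sz.
have sc (v : 'rV[R]_k) : smooth_on T (fun=> v) by exact: smooth_on_cst.
have sD : smooth_on T (fun r => D r a b) by exact: (christoffel_smooth lc').
have scov := smooth_on_cov lc (sE a) (sE b).
have e1 := diff_metric lc (E u z) Sz scov (sE w).
have eq1 q : S q -> G q (local_cov C (E a q) (E b) q) (E w q) =
  H (F q) (D (F q) a b) w.
  move=> Sq; rewrite (local_metric_sym lc) (lift_metric sub)//.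
  by rewrite lift_cov_horizontal// (local_metric_sym lc').
have e2 := diff_eq_on (E u z) oS Sz eq1
  (smooth_on_differentiable (smooth_on_metric lc scov (sE w)) Sz).
have e3 := diff_chain (g := fun r => H r (D r a b) w) (E u z)
  (smooth_on_differentiable (submersion_smooth_on sub) Sz)
  (smooth_on_differentiable (smooth_on_metric lc' sD (sc w)) TF).
rewrite (lift_section sub)// in e3.
have e4 := diff_metric lc' u TF sD (sc w).
have e5 : local_cov D u (fun=> w) (F z) = D (F z) u w.
  by rewrite /local_cov diff_cstE add0r.
rewrite e5 in e4.
have := etrans (esym e1) (etrans e2 (etrans e3 e4)).
by rewrite metric_lift_cov2// /local_cov => e; lra.
Qed.

(** The bracket of [B] and [E y] is vertical, so [nabla_B (E y)] may be replaced by [nabla_(E y) B].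
    Metric compatibility moves the derivative onto [E x], where [lift_covE] gives half a bracket. *)
Lemma metric_cov_vertical (B : 'rV[R]_n -> 'rV[R]_n) y x z : S z -> smooth_on S B ->
  (forall q, S q -> 'd F q (B q) = 0) ->
  G z (local_cov C (B z) (E y) z) (E x z) =
  2^-1 * G z (B z) (local_bracket (E x) (E y) z).
Proof.
move=> Sz sB FB.
have GB q : S q -> G q (B q) (E x q) = 0.
  by move=> Sq; rewrite (local_metric_sym lc) metric_lift_vertical// FB.
have e1 := diff_metric lc (E y z) Sz sB (sE x).
have e2 := diff_eq_on (E y z) oS Sz GB
  (smooth_on_differentiable (smooth_on_metric lc sB (sE x)) Sz).
have {e2}e1 := etrans (esym e1) (etrans e2 (diff_cstE _ _ _)).
have e3 := local_torsion_free lc B (E y) Sz.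
have e4 : G z (local_bracket B (E y) z) (E x z) = 0.
  rewrite (local_metric_sym lc) metric_lift_vertical//.
  apply: (bracket_vertical (x := 0) (y := y) Sz sB (sE y)) => // q Sq.
  exact: (lift_section sub).
rewrite -e3 (local_metricDl lc) (local_metricNl lc) in e4.
rewrite (lift_covE y x Sz) (local_metricDr lc) (local_metricZr lc) in e1.
rewrite (local_metric_sym lc _ (B z) (E _ _)) metric_lift_vertical ?FB// in e1.
rewrite (local_bracketC (E y)) (local_metricNr lc) in e1.
lra.
Qed.

Theorem local_oneill x y z : S z ->
  G z (local_curvature C z (E x z) (E y z) (E y z)) (E x z) =
  H (F z) (local_curvature D (F z) x y y) x +
  3 / 4 * G z (local_bracket (E x) (E y) z) (local_bracket (E x) (E y) z).
Proof.
move=> Sz; have sB := smooth_on_bracket lc (sE x) (sE y).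
have e0 := local_ricci lc Sz (sE x) (sE y) (sE y).
have gen a b c d w : a - b - c = - d -> G z d w = G z b w + G z c w - G z a w.
  move=> e; have -> : d = b + c - a.
    by apply/rowP => i; move/rowP/(_ i) : e; rewrite !mxE => e; lra.
  by rewrite !(local_metricDl lc) (local_metricNl lc).
rewrite (gen _ _ _ _ _ e0) !metric_lift_cov_cov//.
rewrite (metric_cov_vertical y x Sz sB (fun q => @lift_bracket_vertical x y q)).
rewrite [in RHS]/local_curvature [in RHS](local_metricDl lc')
  [in RHS](local_metricNl lc').
rewrite [local_bracket (E y) (E y) z]/local_bracket subrr (local_metric_sym lc _ 0).
rewrite (local_metric0r lc) (local_bracketC (E y) (E x)) (local_metricNr lc).
by field.
Qed.

(** When the projected vectors vary, their derivatives only add a lift; the vertical part of the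
    bracket thus depends on the values at [z] alone. *)
Lemma lift_field_bracket (f g : 'rV[R]_n -> 'rV[R]_k) z : S z ->
  differentiable f z -> differentiable g z ->
  local_bracket (fun q => L q (f q)) (fun q => L q (g q)) z =
  local_bracket (E (f z)) (E (g z)) z +
  L z ('d g z (L z (f z)) - 'd f z (L z (g z))).
Proof.
move=> Sz df dg; have lL := lift_linear sub.
have dL w : differentiable (L ^~ w) z by exact: smooth_on_differentiable (sE w) Sz.
have e1 := diff_app (L z (f z)) lL dg dL.
have e2 := diff_app (L z (g z)) lL df dL.
apply: etrans (congr2 (fun a b => a - b) e1 e2) _.
by rewrite (linear_funB (lL z)) opprD addrACA.
Qed.

Lemma lift_bracket_linear x z : S z ->
  linear (fun y => local_bracket (E x) (E y) z).
Proof.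
move=> Sz c v w; have lL := lift_linear sub.
have d u : differentiable (E u) z by exact: smooth_on_differentiable (sE u) Sz.
have EE : E (c *: v + w) = fun q => c *: E v q + E w q.
  by apply/funext => q; exact: lL.
have e1 : 'd (E (c *: v + w)) z (E x z) = c *:
  'd (E v) z (E x z) + 'd (E w) z (E x z).
  rewrite EE; have e := diffDE (E x z) (differentiableZ c (d v)) (d w).
  exact: etrans e (congr1 (+%R^~ _) (diffZE c (E x z) (d v))).
have e2 := etrans (congr1 ('d (E x) z) (lL z c v w))
  (linearP ('d (E x) z) c (E v z) (E w z)).
apply: etrans (congr2 (fun a b => a - b) e1 e2) _.
by rewrite opprD addrACA -scalerBr.
Qed.

End ONeill.

(** * Manifolds in charts *)

Section Charts.
Context {R : realType} {n : nat} {M : manifold R n}.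
Implicit Types (a b c : chart R M n) (p q : M) (U : set M).

Lemma open_chart_image_sub a U : open U -> open (a @` (chart_dom a `&` U)).
Proof.
move=> oU; rewrite openE => _ [p [ap Up] <-].
have S : \forall z \near a p, (a @` chart_dom a) z.
  by apply: open_near; [exact: open_chart_image|exists p].
have Uu : \forall z \near a p, U (unchart a z).
  have := unchart_continuous ap; apply.
  by rewrite (chartK ap); exact: open_near.
apply: filterS2 S Uu => _ [q aq <-]; rewrite (chartK aq) => Uq.
by exists q.
Qed.

Lemma smooth_on_transition a b U : atlas a -> atlas b -> U `<=` chart_dom b ->
  smooth_on (a @` (chart_dom a `&` U)) (b \o unchart a).
Proof.
move=> aA bA Ub; apply: smooth_on_sub (atlas_compatible aA bA).
by move=> _ [p [ap /Ub bp] <-]; exists p.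
Qed.

Lemma differentiable_transition a b p : atlas a -> atlas b ->
  chart_dom a p -> chart_dom b p -> differentiable (b \o unchart a) (a p).
Proof.
move=> aA bA ap bp;
  apply: smooth_on_differentiable
  (smooth_on_transition aA bA (@subset_refl _ (chart_dom b))) _.
by exists p.
Qed.

Lemma diff_change (W : normedModType R) a b p (f : M -> W) v :
  atlas a -> atlas b -> chart_dom a p -> chart_dom b p ->
  differentiable (f \o unchart a) (a p) ->
  differentiable (f \o unchart b) (b p) /\
  'd (f \o unchart b) (b p) v =
  'd (f \o unchart a) (a p) ('d (a \o unchart b) (b p) v).
Proof.
move=> aA bA ap bp df.
have dt := differentiable_transition bA aA bp ap.
have df' : differentiable (f \o unchart a) ((a \o unchart b) (b p)).
  by rewrite /= (chartK bp).
have fE y : (b @` (chart_dom b `&` chart_dom a)) y ->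
    ((f \o unchart a) \o (a \o unchart b)) y = (f \o unchart b) y.
  by move=> [q [bq aq] <-] /=; rewrite (chartK bq) (chartK aq).
have oI : open (b @` (chart_dom b `&` chart_dom a)).
  exact: open_chart_image_sub (open_chart_dom a).
have Ip : (b @` (chart_dom b `&` chart_dom a)) (b p) by exists p.
have dc := differentiable_comp dt df'.
split.
  by apply: near_eq_differentiable dc; apply: filterS (open_near oI Ip) => y;
    exact: fE.
apply: etrans (esym (diff_eq_on v oI Ip fE dc)) _.
apply: etrans (diff_chain v dt df') _.
by rewrite /= (chartK bp).
Qed.

Lemma transition_comp a b c p v : atlas a -> atlas b -> atlas c ->
  chart_dom a p -> chart_dom b p -> chart_dom c p ->
  'd (c \o unchart b) (b p) ('d (b \o unchart a) (a p) v) =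
  'd (c \o unchart a) (a p) v.
Proof.
move=> aA bA cA ap bp cp.
exact: esym (diff_change (f := c) v bA aA bp ap
  (differentiable_transition bA cA bp cp)).2.
Qed.

Lemma transition_id a p v : atlas a -> chart_dom a p ->
  'd (a \o unchart a) (a p) v = v.
Proof.
move=> aA ap.
have oS : open (a @` chart_dom a) by exact: open_chart_image.
have Sp : (a @` chart_dom a) (a p) by exists p.
have e y : (a @` chart_dom a) y -> id y = (a \o unchart a) y.
  by move=> [q aq <-] /=; rewrite (chartK aq).
by apply: etrans (esym (diff_eq_on v oS Sp e (differentiable_id _))) _;
  exact: diff_idE.
Qed.

(* [extend_tangent p] is [coord_field (chart_at p)]. *)
Definition coord_field a v p := 'd (chart_at p \o unchart a) (a p) v.

Definition chart_field a (X : 'rV[R]_n -> 'rV[R]_n) p := coord_field a (X (a p)) p.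

Lemma tangent_coord_linear a p : linear (tangent_coord a p).
Proof. exact: linearP. Qed.

Lemma coord_field_linear a p : linear (fun v => coord_field a v p).
Proof. exact: linearP. Qed.

Lemma tangent_coord_field a b p v : atlas a -> atlas b ->
  chart_dom a p -> chart_dom b p ->
  tangent_coord b p (coord_field a v p) = 'd (b \o unchart a) (a p) v.
Proof.
by move=> aA bA ap bp; apply: transition_comp => //;
  [exact: atlas_chart_at|exact: dom_chart_at].
Qed.

Lemma coord_fieldK a p v : atlas a -> chart_dom a p ->
  tangent_coord a p (coord_field a v p) = v.
Proof. by move=> aA ap; rewrite tangent_coord_field// transition_id. Qed.

Lemma tangent_coordK a p v : atlas a -> chart_dom a p ->
  coord_field a (tangent_coord a p v) p = v.
Proof.
move=> aA ap; have Ap := atlas_chart_at p; have dp := dom_chart_at p.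
by apply: etrans (transition_comp v Ap aA Ap dp ap dp) _; exact: transition_id.
Qed.

Lemma tangent_coord_at p v : tangent_coord (chart_at p) p v = v.
Proof. exact: transition_id (atlas_chart_at p) (dom_chart_at p). Qed.

Lemma coord_field_at p v : coord_field (chart_at p) v p = v.
Proof. exact: transition_id (atlas_chart_at p) (dom_chart_at p). Qed.

Lemma field_in_chartE a X p : chart_dom a p ->
  field_in_chart a X (a p) = tangent_coord a p (X p).
Proof. by move=> ap; rewrite /field_in_chart (chartK ap). Qed.

Lemma chart_field_in_chart a X p : atlas a -> chart_dom a p ->
  chart_field a (field_in_chart a X) p = X p.
Proof. by move=> aA ap; rewrite /chart_field field_in_chartE// tangent_coordK. Qed.

Lemma smooth_fun_eq U (f g : M -> R) : open U -> (forall p, U p -> f p = g p) ->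
  smooth_fun U f -> smooth_fun U g.
Proof.
move=> oU fg sf a aA; apply: smooth_on_eq (sf a aA).
  exact: open_chart_image_sub.
by move=> _ [p [ap Up] <-] /=; rewrite (chartK ap) fg.
Qed.

Lemma smooth_field_eq U (X Y : M -> 'rV[R]_n) : open U ->
  (forall p, U p -> X p = Y p) ->
  smooth_field U X -> smooth_field U Y.
Proof.
move=> oU XY sX a aA; apply: smooth_on_eq (sX a aA).
  exact: open_chart_image_sub.
by move=> _ [p [ap Up] <-]; rewrite !field_in_chartE// XY.
Qed.

Lemma smooth_field_sub U U' (X : M -> 'rV[R]_n) : U' `<=` U ->
  smooth_field U X -> smooth_field U' X.
Proof.
move=> UU sX a aA; apply: smooth_on_sub (sX a aA).
by move=> _ [p [ap /UU Up] <-]; exists p.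
Qed.

Lemma smooth_fieldD U (X Y : M -> 'rV[R]_n) : open U ->
  smooth_field U X -> smooth_field U Y -> smooth_field U (fun p => X p + Y p).
Proof.
move=> oU sX sY a aA; have oI := open_chart_image_sub (a := a) oU.
apply: smooth_on_eq (smooth_onD oI (sX a aA) (sY a aA)) => // _ [p [ap Up] <-].
by rewrite !field_in_chartE// (linear_funD (tangent_coord_linear a p)).
Qed.

Lemma smooth_fieldZ U (f : M -> R) (X : M -> 'rV[R]_n) : open U ->
  smooth_fun U f -> smooth_field U X -> smooth_field U (fun p => f p *: X p).
Proof.
move=> oU sf sX a aA; have oI := open_chart_image_sub (a := a) oU.
apply: smooth_on_eq (smooth_on_scale oI (sf a aA) (sX a aA)) => // _ [p [ap Up] <-].
by rewrite !field_in_chartE//= (chartK ap) (linear_funZ (tangent_coord_linear a p)).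
Qed.

Lemma smooth_fun_cst U (k : R) : smooth_fun U (fun=> k).
Proof. by move=> a aA; exact: smooth_on_cst. Qed.

Lemma smooth_field0 U : open U -> smooth_field U (fun=> 0).
Proof.
move=> oU a aA; apply: smooth_on_eq (smooth_on_cst _ 0).
  exact: open_chart_image_sub.
by move=> _ [p [ap Up] <-];
  rewrite field_in_chartE// (linear_fun0 (tangent_coord_linear a p)).
Qed.

Lemma smooth_field_sum U I (r : seq I) (X : I -> M -> 'rV[R]_n) : open U ->
  (forall i, smooth_field U (X i)) -> smooth_field U (fun p => \sum_(i <- r) X i p).
Proof.
move=> oU sX; elim: r => [|i r IH].
  by apply: smooth_field_eq (smooth_field0 oU) => // p _; rewrite big_nil.
apply: smooth_field_eq (smooth_fieldD oU (sX i) IH) => // p _.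
by rewrite big_cons.
Qed.

Lemma smooth_fun_chart a U (h : 'rV[R]_n -> R) : atlas a -> open U ->
  U `<=` chart_dom a ->
  smooth_on (a @` U) h -> smooth_fun U (h \o a).
Proof.
move=> aA oU Ua sh b bA.
apply: (smooth_on_comp (T := a @` U) _ _ _ (smooth_on_transition bA aA Ua) sh).
- exact: open_chart_image_sub.
- by rewrite -(setIidr Ua); exact: open_chart_image_sub.
- by move=> _ [p [bp Up] <-] /=; rewrite (chartK bp); exists p.
Qed.

(** In another chart [b] the field is its push-forward by the transition from [a], evaluated after
    the transition back to [a]. *)
Lemma smooth_chart_field a U (X : 'rV[R]_n -> 'rV[R]_n) :
  atlas a -> open U -> U `<=` chart_dom a ->
  smooth_on (a @` U) X -> smooth_field U (chart_field a X).
Proof.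
move=> aA oU Ua sX b bA.
have oaU : open (a @` U) by rewrite -(setIidr Ua); exact: open_chart_image_sub.
pose V := a @` (chart_dom a `&` (U `&` chart_dom b)).
have oV : open V.
  by apply: open_chart_image_sub; apply: openI => //; exact: open_chart_dom.
have sV : smooth_on V (fun y => 'd (b \o unchart a) y (X y)).
  apply: smooth_on_diff_app => //.
    by apply: smooth_on_transition => // p [].
  by apply: smooth_on_sub sX => _ [p [ap [Up bp]] <-]; exists p.
have oI := open_chart_image_sub (a := b) oU.
have VI x : (b @` (chart_dom b `&` U)) x -> V ((a \o unchart b) x).
  move=> [p [bp Up] <-] /=; rewrite (chartK bp).
  by exists p => //; split; [exact: Ua|split].
apply: smooth_on_eq
  (smooth_on_comp oI oV VI (smooth_on_transition bA aA Ua) sV) => //.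
move=> _ [p [bp Up] <-]; rewrite field_in_chartE//= (chartK bp).
by rewrite /chart_field tangent_coord_field//; exact: Ua.
Qed.

Lemma smooth_coord_field a v : atlas a ->
  smooth_field (chart_dom a) (coord_field a v).
Proof.
move=> aA; apply: (smooth_chart_field (X := fun=> v)) => //;
  first exact: open_chart_dom.
exact: smooth_on_cst.
Qed.

End Charts.

(** * Connections and metrics in charts *)

Section FieldsInCharts.
Context {R : realType} {n : nat} {M : manifold R n}.
Implicit Types (a b c : chart R M n) (p q : M) (U : set M) (X Y : M -> 'rV[R]_n).

Lemma field_deriv_chart a X (f : M -> R) p : atlas a -> chart_dom a p ->
  differentiable (f \o unchart a) (a p) ->
  field_deriv X f p = 'd (f \o unchart a) (a p) (tangent_coord a p (X p)).
Proof.
move=> aA ap df.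
have [dc e] := diff_change (X p) aA (atlas_chart_at p) ap (dom_chart_at p) df.
exact: etrans (deriveE _ dc) e.
Qed.

(** [lie_bracket] is computed in the preferred chart. Passing to [a] brings in second derivatives of
    the transition map [phi], which are symmetric and cancel. *)
Lemma lie_bracket_chart a U X Y p : atlas a -> chart_dom a p -> open U -> U p ->
  smooth_field U X -> smooth_field U Y ->
  tangent_coord a p (lie_bracket X Y p) =
  local_bracket (field_in_chart a X) (field_in_chart a Y) (a p).
Proof.
move=> aA ap oU Up sX sY.
pose c := chart_at p; have cA : atlas c := atlas_chart_at p.
have cp : chart_dom c p := dom_chart_at p.
pose phi := c \o unchart a; pose psi := a \o unchart c.
pose V := U `&` (chart_dom a `&` chart_dom c).
have oV : open V by do 2?apply: openI => //; exact: open_chart_dom.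
have Vp : V p by [].
have oVc : open (c @` (chart_dom c `&` V)) by exact: open_chart_image_sub.
have oVa : open (a @` (chart_dom a `&` V)) by exact: open_chart_image_sub.
have Vcp : (c @` (chart_dom c `&` V)) (c p) by exists p.
have Vap : (a @` (chart_dom a `&` V)) (a p) by exists p.
have sphi : smooth_on (a @` (chart_dom a `&` V)) phi.
  by apply: smooth_on_transition => // q [_ []].
have VU : V `<=` U by move=> q [].
have key (A B : M -> 'rV[R]_n) : smooth_field U B ->
    'D_(A p) (field_in_chart c B) (c p) =
    'd (fun y => 'd phi y (field_in_chart a B (a p))) (a p)
      (tangent_coord a p (A p))
    + 'd phi (a p) ('d (field_in_chart a B) (a p) (tangent_coord a p (A p))).
  move=> sB; have sBa := smooth_field_sub VU sB aA; have sBc :=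
    smooth_field_sub VU sB cA.
  have e1 := deriveE (A p) (smooth_on_differentiable sBc Vcp).
  have eB x : (c @` (chart_dom c `&` V)) x ->
      field_in_chart c B x = 'd phi (psi x) (field_in_chart a B (psi x)).
    move=> [q [cq [_ [aq _]]] <-]; rewrite /psi /= (chartK cq) !field_in_chartE//.
    by rewrite -{1}(tangent_coordK (B q) aA aq) (tangent_coord_field _ aA cA aq cq).
  have e2 := diff_eq_on (A p) oVc Vcp eB (smooth_on_differentiable sBc Vcp).
  have psip : psi (c p) = a p by rewrite /psi /= (chartK cp).
  have dphi := smooth_on_differentiable (smooth_on_diff_app oVa sphi sBa) Vap.
  have dphi' : differentiable (fun y => 'd phi y (field_in_chart a B y))
    (psi (c p)).
    by rewrite psip.
  have e3 := diff_chain (A p) (differentiable_transition cA aA cp ap) dphi'.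
  have e4 := diff_diff (tangent_coord a p (A p)) oVa Vap sphi sBa.
  rewrite -/psi psip in e3.
  exact: etrans e1 (etrans e2 (etrans e3 e4)).
have e : lie_bracket X Y p = coord_field a
    (local_bracket (field_in_chart a X) (field_in_chart a Y) (a p)) p.
  apply: etrans (congr2 (fun u v => u - v) (key X Y sY) (key Y X sX)) _.
  rewrite -(field_in_chartE X ap) -(field_in_chartE Y ap).
  have e1 := diff_sym (field_in_chart a X (a p))
    (field_in_chart a Y (a p)) oVa Vap sphi.
  apply: etrans (congr1 (fun u => u + _ - _) e1) _.
  rewrite opprD addrACA subrr add0r.
  exact: esym (linear_funB (coord_field_linear a p) _ _).
by rewrite e coord_fieldK.
Qed.

Lemma coord_field_in_chart a u p : atlas a -> chart_dom a p ->
  field_in_chart a (coord_field a u) (a p) = u.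
Proof. by move=> aA ap; rewrite field_in_chartE// coord_fieldK. Qed.

Lemma diff_coord_field_in_chart a u v p : atlas a -> chart_dom a p ->
  'd (field_in_chart a (coord_field a u)) (a p) v = 0.
Proof.
move=> aA ap; have oS : open (a @` chart_dom a) by exact: open_chart_image.
have Sp : (a @` chart_dom a) (a p) by exists p.
have fE y : (a @` chart_dom a) y -> u = field_in_chart a (coord_field a u) y.
  by move=> [q aq <-]; rewrite coord_field_in_chart.
have e1 := diff_eq_on v oS Sp fE (differentiable_cst u _).
by apply: etrans (esym e1) _; exact: diff_cstE.
Qed.

Lemma lie_bracket_coord_field a u v p : atlas a -> chart_dom a p ->
  lie_bracket (coord_field a u) (coord_field a v) p = 0.
Proof.
move=> aA ap; have oa := open_chart_dom a.
rewrite -[LHS](tangent_coordK _ aA ap).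
have e := lie_bracket_chart aA ap oa ap (smooth_coord_field u aA)
  (smooth_coord_field v aA).
rewrite e.
have d0 w w' := diff_coord_field_in_chart w w' aA ap.
apply: etrans (congr1 (coord_field a ^~ p)
  (congr2 (fun u v => u - v) (d0 v _) (d0 u _))) _.
by rewrite subrr (linear_fun0 (coord_field_linear a p)).
Qed.

End FieldsInCharts.

Section ConnectionsInCharts.
Context {R : realType} {n : nat} {M : manifold R n}.
Variable nabla : (M -> 'rV[R]_n) -> (M -> 'rV[R]_n) -> M -> 'rV[R]_n.
Hypothesis hnabla : is_connection nabla.
Implicit Types (a b c : chart R M n) (p q : M) (U : set M) (X Y : M -> 'rV[R]_n).

(* The difference of two fields that agree on [U] equals its product by the
   indicator function of the complement of [U], which is smooth on [U]. *)
Lemma connection_local U X X' Y Y' p : open U -> U p ->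
  smooth_field U X -> smooth_field U Y ->
  (forall q, U q -> X q = X' q) -> (forall q, U q -> Y q = Y' q) ->
  nabla X Y p = nabla X' Y' p.
Proof.
move=> oU Up sX sY XX YY.
have sX' := smooth_field_eq oU XX sX; have sY' := smooth_field_eq oU YY sY.
pose f q : R := if q \in U then 0 else 1.
have f0 q : U q -> 0 = f q by move=> Uq; rewrite /f mem_set.
have sf : smooth_fun U f by exact: smooth_fun_eq oU f0 (smooth_fun_cst _ 0).
have van Z Z' : smooth_field U Z -> smooth_field U Z' ->
  (forall q, U q -> Z q = Z' q) ->
    exists W, [/\ smooth_field U W, W p = 0, (fun q => Z q + W q) = Z' &
       (fun q => f q *: W q) = W].
  move=> sZ sZ' ZZ; exists (fun q => Z' q - Z q); split.
  - by apply: smooth_field_eq (smooth_field0 oU) => // q Uq; rewrite ZZ// subrr.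
  - by rewrite ZZ// subrr.
  - by apply/funext => q; rewrite addrC subrK.
  - apply/funext => q; have [Uq|nUq] := pselect (U q).
      by rewrite ZZ// subrr scaler0.
    by rewrite /f memNset// scale1r.
have [W [sW Wp <- fW]] := van _ _ sX sX' XX.
have [W' [sW' W'p <- fW']] := van _ _ sY sY' YY.
have sYW := smooth_fieldD oU sY sW'.
have fp : f p = 0 by rewrite -f0.
rewrite (connectionDl hnabla oU sX sW sYW Up) -[in nabla W _ _]fW.
rewrite (connectionZl hnabla oU sf sW sYW Up) fp scale0r addr0.
rewrite (connectionDr hnabla oU sX sY sW' Up) -[in nabla X W' _]fW'.
(* The unknown derivative of [f] multiplies [W' p], which is zero. *)
by rewrite (connection_leibniz hnabla oU sf sX sW' Up) fp scale0r addr0 W'p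
  scaler0 addr0.
Qed.

Lemma connection_suml U Y p I (r : seq I) (X : I -> M -> 'rV[R]_n) : open U ->
  U p ->
  (forall i, smooth_field U (X i)) -> smooth_field U Y ->
  nabla (fun q => \sum_(i <- r) X i q) Y p = \sum_(i <- r) nabla (X i) Y p.
Proof.
move=> oU Up sX sY; elim: r => [|i r IH].
  have e := connectionZl hnabla oU (smooth_fun_cst U 0) (smooth_field0 oU) sY Up.
  rewrite big_nil; apply: etrans (etrans e (scale0r _)).
  by congr (nabla _ _ _); apply/funext => q; rewrite big_nil scaler0.
rewrite big_cons -IH -(connectionDl hnabla oU _ _ sY Up)//;
  last exact: smooth_field_sum.
by congr (nabla _ _ _); apply/funext => q; rewrite big_cons.
Qed.

Lemma connection_sumr U Y p I (r : seq I) (X : I -> M -> 'rV[R]_n) : open U ->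
  U p ->
  (forall i, smooth_field U (X i)) -> smooth_field U Y ->
  nabla Y (fun q => \sum_(i <- r) X i q) p = \sum_(i <- r) nabla Y (X i) p.
Proof.
move=> oU Up sX sY; elim: r => [|i r IH].
  have s0 := smooth_field0 (M := M) oU.
  have e := connectionDr hnabla oU sY s0 s0 Up.
  have e0 : (fun q : M => 0 + 0) = (fun=> 0) :> (M -> 'rV[R]_n).
    by apply/funext => q; rewrite addr0.
  rewrite e0 in e.
  have {}e : nabla Y (fun=> 0) p = 0.
    by apply: (@addrI _ (nabla Y (fun=> 0) p)); rewrite addr0; exact: esym e.
  rewrite big_nil -[RHS]e.
  by congr (nabla _ _ _); apply/funext => q; rewrite big_nil.
rewrite big_cons -IH -(connectionDr hnabla oU sY _ _ Up)//;
  last exact: smooth_field_sum.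
by congr (nabla _ _ _); apply/funext => q; rewrite big_cons.
Qed.

(* Defined from the values on a basis so as to be bilinear at every [z], even
   outside the image of the chart. *)
Definition christoffel a (z u v : 'rV[R]_n) : 'rV[R]_n :=
  \sum_(i < n) u 0 i *: \sum_(j < n) v 0 j *: field_in_chart a
    (nabla (coord_field a (delta_mx 0 i)) (coord_field a (delta_mx 0 j))) z.

Lemma christoffel_is_linear a z u : linear (christoffel a z u).
Proof.
move=> k v w; rewrite /christoffel scaler_sumr -big_split /=; apply: eq_bigr => i _.
rewrite scalerA mulrC -scalerA -scalerDr; congr (_ *: _).
rewrite scaler_sumr -big_split /=.
by apply: eq_bigr => j _; rewrite !mxE scalerDl scalerA.
Qed.

Lemma christoffel_is_linearl a z v : linear (fun u => christoffel a z u v).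
Proof.
move=> k u w; rewrite /christoffel scaler_sumr -big_split /=; apply: eq_bigr => i _.
by rewrite !mxE scalerDl scalerA.
Qed.

Lemma christoffel_is_smooth a u v : atlas a ->
  smooth_on (a @` chart_dom a) (fun z => christoffel a z u v).
Proof.
move=> aA; have oS : open (a @` chart_dom a) by exact: open_chart_image.
have oa := open_chart_dom a.
apply: smooth_on_sum => // i _; apply: smooth_on_scale => //;
  first exact: smooth_on_cst.
apply: smooth_on_sum => // j _; apply: smooth_on_scale => //;
  first exact: smooth_on_cst.
have := connection_smooth hnabla oa (smooth_coord_field (delta_mx 0 i) aA)
  (smooth_coord_field (delta_mx 0 j) aA).
by move=> /(_ a aA); rewrite setIid.
Qed.

Lemma chart_field_sum a U X p : atlas a -> chart_dom a p ->
  X p = \sum_(i < n) field_in_chart a X (a p) 0 i *: coord_field a (delta_mx 0 i) p.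
Proof.
move=> aA ap; rewrite -{1}(chart_field_in_chart X aA ap) /chart_field.
exact: linear_row (coord_field_linear a p) _.
Qed.

(** Both fields are expanded in the coordinate frame, which is legitimate by [connection_local]
    although the expansions hold only on [U]; the Leibniz rule gives the derivative of [Y] and the
    frame gives the Christoffel term. *)
Lemma connection_chart a U X Y p : atlas a -> open U -> U p -> U `<=` chart_dom a ->
  smooth_field U X -> smooth_field U Y ->
  tangent_coord a p (nabla X Y p) =
  local_cov (christoffel a) (field_in_chart a X (a p)) (field_in_chart a Y) (a p).
Proof.
move=> aA oU Up Ua sX sY; have ap := Ua _ Up.
have aU : chart_dom a `&` U = U by exact: setIidr.
have oaU : open (a @` U) by rewrite -aU; exact: open_chart_image_sub.
have aUp : (a @` U) (a p) by exists p.
have sc i := smooth_field_sub Ua (smooth_coord_field (delta_mx 0 i) aA).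
have sXa : smooth_on (a @` U) (field_in_chart a X) by have := sX a aA; rewrite aU.
have sYa : smooth_on (a @` U) (field_in_chart a Y) by have := sY a aA; rewrite aU.
have sco Z i : smooth_on (a @` U) (field_in_chart a Z) ->
    smooth_fun U ((fun y => field_in_chart a Z y 0 i) \o a).
  by move=> sZ; apply: smooth_fun_chart => // k; apply: Ck_on_coord => //;
    exact: sZ.
pose f i := (fun y => field_in_chart a X y 0 i) \o a.
pose g i := (fun y => field_in_chart a Y y 0 i) \o a.
pose e i := coord_field a (delta_mx 0 i).
have sfe i : smooth_field U (fun q => f i q *: e i q).
  exact: (smooth_fieldZ oU (sco X i sXa) (sc i)).
have sge i : smooth_field U (fun q => g i q *: e i q).
  exact: (smooth_fieldZ oU (sco Y i sYa) (sc i)).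
have sS h : (forall i, smooth_field U (fun q => h i q *: e i q)) ->
    smooth_field U (fun q => \sum_(i < n) h i q *: e i q).
  by move=> sh; exact: smooth_field_sum.
have XE q : U q -> X q = \sum_(i < n) f i q *: e i q.
  by move=> Uq; apply: chart_field_sum => //; exact: Ua.
have YE q : U q -> Y q = \sum_(i < n) g i q *: e i q.
  by move=> Uq; apply: chart_field_sum => //; exact: Ua.
have sX' := sS f sfe; have sY' := sS g sge.
rewrite (connection_local oU Up sX sY XE YE).
rewrite (connection_suml _ oU Up sfe sY').
have lt := tangent_coord_linear a p.
rewrite (linear_fun_sum _ _ _ lt) /local_cov.
rewrite (linear_row (linearP ('d (field_in_chart a Y) (a p)))) /christoffel
  -big_split /=.
apply: eq_bigr => i _.
rewrite (connectionZl hnabla oU (sco X i sXa) (sc i) sY' Up) (linear_funZ lt).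
rewrite -scalerDr; congr (_ *: _).
rewrite (connection_sumr _ oU Up sge (sc i)) (linear_fun_sum _ _ _ lt).
rewrite [X in _ = X + _]row_sum_delta -big_split /=; apply: eq_bigr => j _.
rewrite (connection_leibniz hnabla oU (sco Y j sYa) (sc i) (sc j) Up).
rewrite (linear_funD lt) !(linear_funZ lt) coord_fieldK// -field_in_chartE//.
congr (_ *: _ + _).
have dY := smooth_on_differentiable sYa aUp.
have dg : differentiable (g j \o unchart a) (a p).
  have := sco Y j sYa a aA; rewrite aU => sg.
  exact: smooth_on_differentiable sg aUp.
rewrite (field_deriv_chart _ aA ap dg) coord_fieldK//.
have gE y : (a @` U) y -> (g j \o unchart a) y = field_in_chart a Y y 0 j.
  by move=> [q Uq <-]; rewrite /g /= (chartK (Ua _ Uq)).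
have e1 := diff_eq_on (delta_mx 0 i) oaU aUp gE dg.
apply: etrans e1 _.
have e2 := deriveE (delta_mx 0 i) (coord_differentiable j dY).
apply: etrans (esym e2) _.
by rewrite coord_derive// deriveE.
Qed.

Lemma connection_coord_field a u v p : atlas a -> chart_dom a p ->
  tangent_coord a p (nabla (coord_field a u) (coord_field a v) p) =
  christoffel a (a p) u v.
Proof.
move=> aA ap; have oa := open_chart_dom a.
rewrite (connection_chart aA oa ap (@subset_refl _ _) (smooth_coord_field u aA)
  (smooth_coord_field v aA)).
have e := diff_coord_field_in_chart v
  (field_in_chart a (coord_field a u) (a p)) aA ap.
apply: etrans (congr1 (+%R^~ _) e) _.
by rewrite add0r !coord_field_in_chart.
Qed.

Lemma curvatureE p x y z : curvature nabla p x y z =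
  local_curvature (christoffel (chart_at p)) (chart_at p p) x y z.
Proof.
pose a := chart_at p; have aA : atlas a := atlas_chart_at p.
have ap : chart_dom a p := dom_chart_at p.
have oa := open_chart_dom a; have sub := @subset_refl _ (chart_dom a).
pose e := @coord_field R n M a.
have se u : smooth_field (chart_dom a) (e u) by exact: smooth_coord_field.
have lb0 q : chart_dom a q -> (fun _ : M => 0) q = lie_bracket (e x) (e y) q.
  by move=> aq; rewrite lie_bracket_coord_field.
have slb := smooth_field_eq oa lb0 (smooth_field0 oa).
(* The bracket of coordinate fields vanishes only on the chart domain, so the term is evaluated
   through [connection_chart]. *)
have e1 : nabla (lie_bracket (e x) (e y)) (e z) p = 0.
  rewrite -[LHS](@tangent_coord_at R n M p)
    (connection_chart aA oa ap sub slb (se z)).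
  have -> : field_in_chart a (lie_bracket (e x) (e y)) (a p) = 0.
    by rewrite field_in_chartE// -lb0// (linear_fun0 (tangent_coord_linear a p)).
  by rewrite /local_cov linear0 add0r (linear_fun0 (christoffel_is_linearl _ _ _)).
have e2 u v w : nabla (e u) (nabla (e v) (e w)) p =
    'd (fun t => christoffel a t v w) (a p) u +
      christoffel a (a p) u (christoffel a (a p) v w).
  have sn := connection_smooth hnabla oa (se v) (se w).
  rewrite -[LHS](@tangent_coord_at R n M p)
    (connection_chart aA oa ap sub (se u) sn).
  have oS : open (a @` chart_dom a) by exact: open_chart_image.
  have Sp : (a @` chart_dom a) (a p) by exists p.
  have eq1 t : (a @` chart_dom a) t -> christoffel a t v w =
    field_in_chart a (nabla (e v) (e w)) t.
    by move=> [q aq <-]; rewrite field_in_chartE// connection_coord_field.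
  have sC := christoffel_is_smooth v w aA.
  have e3 := diff_eq_on u oS Sp eq1 (smooth_on_differentiable sC Sp).
  rewrite (coord_field_in_chart u aA ap).
  exact: esym (congr2 +%R e3 (congr1 (christoffel a (a p) u) (eq1 _ Sp))).
rewrite /curvature /curvature_field -[extend_tangent p x]/(e x)
  -[extend_tangent p y]/(e y).
by rewrite -[extend_tangent p z]/(e z) e1 !e2 sub0r.
Qed.

End ConnectionsInCharts.

Section LeviCivitaInCharts.
Context {R : realType} {n : nat} {M : manifold R n}.
Variables (g : metric M)
  (nabla : (M -> 'rV[R]_n) -> (M -> 'rV[R]_n) -> M -> 'rV[R]_n).
Hypothesis hg : levi_civita g nabla.

Lemma inner_linear p u : linear (inner g p u).
Proof. exact: linearP. Qed.

Lemma inner_sym p u v : inner g p u v = inner g p v u.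
Proof. exact: Defs.metric_sym. Qed.

Definition chart_metric (a : chart R M n) (z u v : 'rV[R]_n) : R :=
  inner g (unchart a z) (coord_field a u (unchart a z))
    (coord_field a v (unchart a z)).

Lemma chart_metricE a p u v : chart_dom a p ->
  chart_metric a (a p) u v = inner g p (coord_field a u p) (coord_field a v p).
Proof. by move=> ap; rewrite /chart_metric (chartK ap). Qed.

Lemma local_levi_civita_chart (a : chart R M n) : atlas a ->
  local_levi_civita (a @` chart_dom a) (chart_metric a) (christoffel nabla a).
Proof.
move=> aA; have oa := open_chart_dom a; have hn := levi_civita_connection hg.
have sc u := smooth_coord_field (M := M) u aA.
have smooth_metric u v :
  smooth_on (a @` chart_dom a) (fun z => chart_metric a z u v).
  by have := metric_smooth g oa (sc u) (sc v) aA; rewrite setIid.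
split.
- exact: open_chart_image.
- move=> z u k v w; rewrite /chart_metric (coord_field_linear a _ k v w).
  exact: inner_linear.
- by move=> z u v; exact: inner_sym.
- move=> z u [p ap <-] u0; rewrite chart_metricE//; apply: metric_pos.
  apply: contra_neq u0 => e0; rewrite -(coord_fieldK u aA ap) e0.
  exact: linear_fun0 (tangent_coord_linear a p).
- exact: smooth_metric.
- exact: christoffel_is_linear.
- exact: christoffel_is_linearl.
- move=> z u v [p ap <-]; rewrite -!(connection_coord_field hn _ _ aA ap).
  apply/eqP; rewrite -subr_eq0 -(linear_funB (tangent_coord_linear a p)).
  rewrite (torsion_free hg oa (sc u) (sc v) ap) lie_bracket_coord_field//.
  by rewrite (linear_fun0 (tangent_coord_linear a p)).
- by move=> u v; exact: christoffel_is_smooth.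
- move=> z u v w [p ap <-].
  have Sp : (a @` chart_dom a) (a p) by exists p.
  have d := smooth_on_differentiable (smooth_metric v w) Sp.
  have e := metric_compatible hg oa (sc u) (sc v) (sc w) ap.
  have fE := field_deriv_chart (f :=
    fun q => inner g q (coord_field a v q) (coord_field a w q))
    (coord_field a u) aA ap d.
  rewrite coord_fieldK// in fE.
  apply: etrans (esym fE) (etrans e _).
  by rewrite !chart_metricE// -!(connection_coord_field hn _ _ aA ap)
    !tangent_coordK.
Qed.

End LeviCivitaInCharts.

(** * Riemannian submersions *)

Lemma memv_bigcap_lker (K : fieldType) (U W : vectType K) (s : seq U)
    (h : U -> 'Hom(U, W)) x :
  (x \in (\bigcap_(v <- s) lker (h v))%VS) = all (fun v => h v x == 0) s.
Proof.
elim: s => [|v s IH]; first by rewrite big_nil memvf.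
by rewrite big_cons memv_cap memv_ker IH.
Qed.

(** Each linear form lowers the dimension by at most one. With disjointness, this bound makes
    [horizontal] and [vertical] span the tangent space. *)
Lemma dim_bigcap_lker (K : fieldType) (U : vectType K) (s : seq U)
    (h : U -> 'Hom(U, K^o)) :
  (dim U <= \dim (\bigcap_(v <- s) lker (h v)) + size s)%N.
Proof.
elim: s => [|v s IH]; first by rewrite big_nil dimvf addn0.
rewrite big_cons capvC; set A := (\bigcap_(v <- s) _)%VS in IH *.
apply: leq_trans IH _; rewrite -(limg_ker_dim (h v) A) -addnA leq_add2l.
rewrite -[size (v :: s)]add1n leq_add2r.
apply: leq_trans (dimvS (subvf _)) _; rewrite dimvf.
by rewrite /dim /=.
Qed.

Section Submersion.
Context {R : realType} {n k : nat} {M : manifold R n} {N : manifold R k}.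
Variables (gM : metric M) (gN : metric N) (f : M -> N).
Hypothesis hf : riemannian_submersion gM gN f.
Implicit Types (p : M) (x y u v : 'rV[R]_n).

Lemma mem_horizontal p x : x \in horizontal gM f p <->
  (forall v, v \in vertical f p -> inner gM p v x = 0).
Proof.
rewrite /horizontal memv_bigcap_lker; split.
  move=> /allP hx v Vv; rewrite (coord_vbasis Vv) inner_sym.
  rewrite (linear_fun_sum _ _ _ (inner_linear gM p x)); apply: big1 => i _.
  rewrite (linear_funZ (inner_linear gM p x)) inner_sym /inner.
  have /hx/eqP -> : (vbasis (vertical f p))`_i \in vbasis (vertical f p).
    by rewrite mem_nth// size_tuple.
  by rewrite scaler0.
by move=> hx; apply/allP => v Vv; apply/eqP; apply: hx; exact: vbasis_mem.
Qed.

Lemma inner_eq0 p x : inner gM p x x = 0 -> x = 0.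
Proof.
move=> x0; apply/eqP; apply: contraT => /(metric_pos gM p).
by rewrite -/(inner gM p x x) x0 ltxx.
Qed.

Lemma horizontal_vertical0 p : (horizontal gM f p :&: vertical f p = 0)%VS.
Proof.
apply/eqP; rewrite -subv0; apply/subvP => x; rewrite memv_cap => /andP[hx vx].
by rewrite memv0; apply/eqP/(@inner_eq0 p); apply: (mem_horizontal p x).1.
Qed.

Lemma horizontal_add_vertical p : (horizontal gM f p + vertical f p = fullv)%VS.
Proof.
apply/eqP; rewrite eqEdim subvf /= dimv_disjoint_sum ?horizontal_vertical0// dimvf.
have := dim_bigcap_lker (vbasis (vertical f p)) (metric_form gM p).
by rewrite size_tuple.
Qed.

Lemma hproj_horizontal p x : hproj gM f p x \in horizontal gM f p.
Proof. exact: memv_pi. Qed.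

Lemma hproj_vertical p x : x - hproj gM f p x \in vertical f p.
Proof.
have := @daddv_pi_add _ _ _ _ x (horizontal_vertical0 p).
rewrite horizontal_add_vertical memvf => /(_ isT) e.
by rewrite -{1}e [X in X - _]addrC addrK memv_pi.
Qed.

Lemma inner_hproj p u x : x \in horizontal gM f p ->
  inner gM p (hproj gM f p u) x = inner gM p u x.
Proof.
move=> /mem_horizontal/(_ _ (hproj_vertical p u)).
rewrite inner_sym (linear_funB (inner_linear gM p x)) !(inner_sym _ _ x).
by move=> /eqP; rewrite subr_eq0 => /eqP ->.
Qed.

Lemma tangent_map_hproj p u : tangent_map f p (hproj gM f p u) = tangent_map f p u.
Proof.
have := hproj_vertical p u; rewrite memv_ker linearB /= subr_eq0 => /eqP ->.
by [].
Qed.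

(** Only one argument need be horizontal: the vertical part of [u] is seen neither by [x] nor by the
    tangent map. *)
Lemma inner_horizontal p x u : x \in horizontal gM f p ->
  inner gM p x u = inner gN (f p) (tangent_map f p x) (tangent_map f p u).
Proof.
move=> hx; rewrite inner_sym -inner_hproj// inner_sym -(submersion_isometry hf)//.
  by rewrite tangent_map_hproj.
exact: hproj_horizontal.
Qed.

Lemma tangent_map_surj p w : exists2 x,
  x \in horizontal gM f p & tangent_map f p x = w.
Proof.
exists (hproj gM f p ((tangent_map f p)^-1%VF w)); first exact: hproj_horizontal.
by rewrite tangent_map_hproj limg_lfunVK// (submersion_rank hf) memvf.
Qed.

Lemma inner_horizontal_lift p w x : x \in horizontal gM f p ->
  inner gM p (horizontal_lift gM f p w) x = inner gN (f p) w (tangent_map f p x).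
Proof.
move=> hx; rewrite inner_horizontal; last exact: hproj_horizontal.
by rewrite tangent_map_hproj limg_lfunVK// (submersion_rank hf) memvf.
Qed.

Definition submersion_dom (a : chart R M n) (b : chart R N k) :=
  a @` (chart_dom a `&` f @^-1` chart_dom b).

Definition chart_submersion (a : chart R M n) (b : chart R N k) :=
  b \o f \o unchart a.

Lemma open_preimage (b : chart R N k) : open (f @^-1` chart_dom b).
Proof. by apply: open_comp (open_chart_dom b) => p _;
  exact: (submersion_smooth hf).1. Qed.

Lemma open_submersion_dom a b : open (submersion_dom a b).
Proof. exact: open_chart_image_sub (open_preimage b). Qed.

Lemma smooth_chart_submersion a b : atlas a -> atlas b ->
  smooth_on (submersion_dom a b) (chart_submersion a b).
Proof. by move=> aA bA; exact: (submersion_smooth hf).2. Qed.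

(** [tangent_map] uses the preferred charts of each point, whereas the local computation needs one
    pair of charts on a whole neighbourhood. *)
Lemma tangent_map_chart a b p u : atlas a -> atlas b ->
  chart_dom a p -> chart_dom b (f p) ->
  tangent_map f p (coord_field a u p) =
  coord_field b ('d (chart_submersion a b) (a p) u) (f p).
Proof.
move=> aA bA ap bfp.
pose c := chart_at p; pose c' := chart_at (f p).
have cA : atlas c := atlas_chart_at p; have cA' : atlas c' := atlas_chart_at (f p).
have cp : chart_dom c p := dom_chart_at p.
have cp' : chart_dom c' (f p) := dom_chart_at (f p).
have d a' b' : atlas a' -> atlas b' -> chart_dom a' p -> chart_dom b' (f p) ->
    differentiable (chart_submersion a' b') (a' p).
  move=> aA' bA' ap' bfp';
    apply: smooth_on_differentiable (smooth_chart_submersion aA' bA') _.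
  by exists p.
have e1 := (diff_change (f := c' \o f) (coord_field a u p) aA cA ap cp
  (d _ _ aA cA' ap cp')).2.
have e2 := etrans (transition_comp u aA cA aA ap cp ap) (transition_id u aA ap).
have dF := d _ _ aA bA ap bfp.
have Fa : chart_submersion a b (a p) = b (f p)
  by rewrite /chart_submersion /= (chartK ap).
have dt : differentiable (c' \o unchart b) (chart_submersion a b (a p)).
  by rewrite Fa; exact: differentiable_transition.
have e3 := diff_chain u dF dt.
pose D := a @` (chart_dom a `&` (f @^-1` chart_dom b `&` f @^-1` chart_dom c')).
have oD : open D by apply: open_chart_image_sub; apply: openI; exact: open_preimage.
have Dap : D (a p) by exists p.
have eD y : D y -> (c' \o f \o unchart a) y =
  (c' \o unchart b) (chart_submersion a b y).
  by move=> [q [aq [bq _]] <-];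
    rewrite /chart_submersion /= (chartK aq) (chartK bq).
have e4 := diff_eq_on u oD Dap eD (d _ _ aA cA' ap cp').
rewrite /tangent_map lfunE /=.
apply: etrans e1 _; apply: etrans (congr1 _ e2) _; apply: etrans e4 _.
by apply: etrans e3 _; rewrite Fa.
Qed.

End Submersion.

(** * Smooth horizontal lifts, O'Neill's formula and integrability on the manifold *)

Section Lift.
Context {R : realType} {n k : nat} {M : manifold R n} {N : manifold R k}.
Variables (gM : metric M) (gN : metric N) (f : M -> N).
Variables (nablaM : (M -> 'rV[R]_n) -> (M -> 'rV[R]_n) -> M -> 'rV[R]_n).
Variables (nablaN : (N -> 'rV[R]_k) -> (N -> 'rV[R]_k) -> N -> 'rV[R]_k).
Hypotheses (hM : levi_civita gM nablaM) (hN : levi_civita gN nablaN).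
Hypothesis hf : riemannian_submersion gM gN f.

Section InCharts.
Variables (a : chart R M n) (b : chart R N k).
Hypotheses (aA : atlas a) (bA : atlas b).

Let S := submersion_dom f a b.
Let T := b @` chart_dom b.
Let G := chart_metric gM a.
Let H := chart_metric gN b.
Let F := chart_submersion f a b.
Let lM : local_levi_civita (a @` chart_dom a) G (christoffel nablaM a) :=
  local_levi_civita_chart hM aA.
Let lN : local_levi_civita T H (christoffel nablaN b) :=
  local_levi_civita_chart hN bA.
Let oS : open S.
Proof. exact: (@open_submersion_dom _ _ _ _ _ _ _ _ hf a b). Qed.

Let Sa z : S z -> (a @` chart_dom a) z.
Proof. by move=> [p [ap _] <-]; exists p. Qed.

Definition gram_matrix z :=
  \matrix_(i < n, j < n) G z (delta_mx 0 i) (delta_mx 0 j).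

(** The 1-form dual to [w], pulled back along [F]; raising its index with the metric gives the
    lift. *)
Definition lift_covector z w := \row_(j < n) H (F z) w ('d F z (delta_mx 0 j)).

(* The vector [l] such that [G z l u = H (F z) w ('d F z u)] for all [u]. *)
Definition chart_lift z w := lift_covector z w *m invmx (gram_matrix z).

Lemma mul_gram_matrix z v j : (v *m gram_matrix z) 0 j = G z v (delta_mx 0 j).
Proof.
rewrite mxE (linear_row (local_metric_linearl lM z _)).
by apply: eq_bigr => i _; rewrite mxE.
Qed.

Lemma gram_matrix_unit z : S z -> gram_matrix z \in unitmx.
Proof.
move=> /Sa Sz; rewrite -row_free_unit -kermx_eq0;
  apply/eqP/eqP/rowV0P => v /sub_kermxP v0.
apply: (local_metric_eq0 lM Sz); rewrite (linear_row (local_metric_linear lM z v)).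
by apply: big1 => j _; rewrite -mul_gram_matrix v0 mxE scaler0.
Qed.

Lemma chart_lift_metric z w u : S z -> G z (chart_lift z w) u =
  H (F z) w ('d F z u).
Proof.
move=> Sz; rewrite (linear_row (local_metric_linear lM z _)).
rewrite {2}(row_sum_delta u) linear_sum /=.
rewrite (linear_fun_sum _ _ _ (local_metric_linear lN _ w)).
apply: eq_bigr => j _; rewrite -mul_gram_matrix mulmxKV ?gram_matrix_unit// mxE.
by rewrite linearZ (linear_funZ (local_metric_linear lN _ w)).
Qed.

Lemma chart_lift_linear z : linear (chart_lift z).
Proof.
move=> c v w; rewrite /chart_lift scalemxAl -mulmxDl; congr (_ *m _).
apply/rowP => j;
  rewrite !mxE (local_metric_sym lN) (local_metricDr lN) (local_metricZr lN).
by rewrite !(local_metric_sym lN _ ('d F z _)).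
Qed.

Lemma submersion_dom_maps z : S z -> T (F z).
Proof.
move=> [p [ap bfp] <-]; exists (f p) => //.
by rewrite /F /chart_submersion /= (chartK ap).
Qed.

Lemma chart_lift_smooth w : smooth_on S (chart_lift ^~ w).
Proof.
have sF : smooth_on S F := smooth_chart_submersion hf aA bA.
have oT : open T by exact: open_chart_image.
have sG i j : smooth_on S (fun z => gram_matrix z i j).
  apply: smooth_on_eq
    (smooth_on_sub Sa (local_metric_smooth lM (delta_mx 0 i) (delta_mx 0 j))) => //.
  by move=> z _; rewrite mxE.
have sI i j := smooth_on_invmx i j oS gram_matrix_unit sG.
have sl j : smooth_on S (fun z => lift_covector z w 0 j).
  have s1 := smooth_on_app (B := fun z u => H (F z) w u)
    (fun z => local_metric_linear lN _ w) oS
    (smooth_on_diff (delta_mx 0 j) oS sF)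
    (fun u => smooth_on_comp oS oT submersion_dom_maps sF
      (local_metric_smooth lN w u)).
  by apply: smooth_on_eq s1 => // z _; rewrite mxE.
move=> m; apply: Ck_on_row => // i.
have s : smooth_on S
  (fun z => \sum_j lift_covector z w 0 j * invmx (gram_matrix z) j i).
  by apply: smooth_on_sum => // j _; exact: smooth_onM.
by apply: Ck_on_eq (s m) => // z _; rewrite mxE.
Qed.

(** Surjectivity of the tangent map provides a horizontal [l] over [w]; it satisfies the equation
    that characterizes the lift, so it is the lift. *)
Lemma chart_lift_section z w : S z -> 'd F z (chart_lift z w) = w.
Proof.
move=> Sz; move: (Sz) => [p [ap bfp] zp].
have [l hl Tl] := tangent_map_surj hf p (coord_field b w (f p)).
have le : coord_field a (tangent_coord a p l) p = l by exact: tangent_coordK.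
have FE u := tangent_map_chart hf u aA bA ap bfp.
have Fz : F z = b (f p) by rewrite -zp /F /chart_submersion /= (chartK ap).
have -> : chart_lift z w = tangent_coord a p l.
  apply: (local_metric_inj lM (Sa Sz)) => u.
  rewrite chart_lift_metric// -zp /G chart_metricE// le (inner_horizontal hf _ hl).
  by rewrite Tl FE zp Fz /H chart_metricE.
have := FE (tangent_coord a p l);
  rewrite le Tl zp => /(congr1 (tangent_coord b (f p))).
by rewrite !coord_fieldK.
Qed.

Lemma local_submersion_chart : local_submersion S T G H F chart_lift.
Proof.
split.
- exact: submersion_dom_maps.
- exact: (smooth_chart_submersion hf aA bA).
- by move=> z c v w; apply: chart_lift_linear.
- by move=> w; exact: chart_lift_smooth.
- by move=> z w; exact: chart_lift_section.
- by move=> z w u; exact: chart_lift_metric.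
Qed.

Lemma local_levi_civita_submersion : local_levi_civita S G (christoffel nablaM a).
Proof. exact: local_levi_civita_sub oS Sa lM. Qed.

Lemma chart_lift_horizontal p x : chart_dom a p -> chart_dom b (f p) ->
  x \in horizontal gM f p ->
  chart_lift (a p) ('d F (a p) (tangent_coord a p x)) = tangent_coord a p x.
Proof.
move=> ap bfp hx; have Sp : S (a p) by exists p.
have Fz : F (a p) = b (f p) by rewrite /F /chart_submersion /= (chartK ap).
apply: (local_metric_inj lM (Sa Sp)) => u; rewrite chart_lift_metric// Fz.
rewrite /G /H !chart_metricE// tangent_coordK// (inner_horizontal hf _ hx).
by rewrite -!(tangent_map_chart hf)// !tangent_coordK.
Qed.

Lemma horizontal_chart_lift p w : chart_dom a p -> chart_dom b (f p) ->
  coord_field a (chart_lift (a p) w) p \in horizontal gM f p.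
Proof.
move=> ap bfp; have Sp : S (a p) by exists p.
apply/mem_horizontal => v; rewrite memv_ker => /eqP Tv.
rewrite -(tangent_coordK v aA ap) inner_sym -(chart_metricE gM _ _ ap).
rewrite -/G chart_lift_metric//.
have := tangent_map_chart hf (tangent_coord a p v) aA bA ap bfp.
rewrite tangent_coordK// Tv => /esym/(congr1 (tangent_coord b (f p))).
rewrite coord_fieldK// => ->.
by rewrite (linear_fun0 (tangent_coord_linear b _))
  (linear_fun0 (local_metric_linear lN _ _)).
Qed.

End InCharts.

Section AtPoint.
Variable p : M.
Let a := chart_at p.
Let b := chart_at (f p).
Let aA : atlas a := atlas_chart_at p.
Let bA : atlas b := atlas_chart_at (f p).
Let ap : chart_dom a p := dom_chart_at p.
Let bfp : chart_dom b (f p) := dom_chart_at (f p).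
Let F := chart_submersion f a b.
Let L := chart_lift a b.
Let Sp : submersion_dom f a b (a p).
Proof. by exists p. Qed.
Let lM := local_levi_civita_submersion b aA.
Let lN := local_levi_civita_chart hN bA.
Let lS := local_submersion_chart aA bA.

(** For horizontal [x] and [y] this is [2 A_x y], with [A] the O'Neill tensor. *)
Definition oneill_bracket x y :=
  local_bracket (L ^~ (tangent_map f p x)) (L ^~ (tangent_map f p y)) (a p).

Lemma chart_submersion_at : F (a p) = b (f p).
Proof. by rewrite /F /chart_submersion /= (chartK ap). Qed.

Lemma diff_chart_submersion_at u : 'd F (a p) u = tangent_map f p u.
Proof. by rewrite /tangent_map lfunE. Qed.

Lemma chart_lift_at x : x \in horizontal gM f p -> L (a p) (tangent_map f p x) = x.
Proof.
move=> hx; have := chart_lift_horizontal aA bA ap bfp hx.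
by rewrite tangent_coord_at diff_chart_submersion_at.
Qed.

Lemma chart_metric_at u v : chart_metric gM a (a p) u v = inner gM p u v.
Proof. by rewrite chart_metricE// !coord_field_at. Qed.

Lemma chart_metric_at_image u v : chart_metric gN b (F (a p)) u v =
  inner gN (f p) u v.
Proof. by rewrite chart_submersion_at chart_metricE// !coord_field_at. Qed.

Lemma oneill_bracket_vertical x y : oneill_bracket x y \in vertical f p.
Proof.
rewrite memv_ker -diff_chart_submersion_at; apply/eqP.
exact: (lift_bracket_vertical lM lS _ _ Sp).
Qed.

Lemma oneill_bracket_linear x : linear (oneill_bracket x).
Proof.
move=> c v w; have e := linearP (tangent_map f p) c v w.
rewrite /oneill_bracket e.
exact: (lift_bracket_linear lS _ Sp).
Qed.

Lemma oneill_bracketC x y : oneill_bracket x y = - oneill_bracket y x.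
Proof. exact: local_bracketC. Qed.

Lemma oneill x y : x \in horizontal gM f p -> y \in horizontal gM f p ->
  inner gM p (curvature_star gM f nablaN p x y y) x =
  inner gM p (curvature nablaM p x y y) x -
  3 / 4 * inner gM p (oneill_bracket x y) (oneill_bracket x y).
Proof.
move=> hx hy.
have := local_oneill lM lN lS (tangent_map f p x) (tangent_map f p y) Sp.
rewrite -/L -/F !chart_lift_at// chart_metric_at chart_metric_at_image
  chart_metric_at.
rewrite chart_submersion_at -(curvatureE (levi_civita_connection hM)).
rewrite -(curvatureE (levi_civita_connection hN)) => ->.
rewrite /curvature_star (inner_horizontal_lift hf)//.
by rewrite addrK.
Qed.

End AtPoint.

(** Pointwise vanishing controls brackets of lifts of constant vectors only; [lift_field_bracket]
    extends it to all horizontal fields. Conversely these lifts are themselves horizontal fields. *)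
Lemma oneill_bracket_eq0_integrable :
  (forall p x y, x \in horizontal gM f p -> y \in horizontal gM f p ->
     oneill_bracket p x y = 0) <-> horizontal_integrable gM f.
Proof.
split.
  move=> B0 U X Y oU sX sY XYh p Up.
  pose a := chart_at p; pose b := chart_at (f p).
  have aA : atlas a := atlas_chart_at p; have bA : atlas b := atlas_chart_at (f p).
  have ap : chart_dom a p := dom_chart_at p.
  have bfp : chart_dom b (f p) := dom_chart_at (f p).
  pose F := chart_submersion f a b; pose L := chart_lift a b.
  have lM := local_levi_civita_submersion b aA.
  have lS := local_submersion_chart aA bA.
  pose V := U `&` (f @^-1` chart_dom b).
  have oV : open V by apply: openI => //; exact: open_preimage hf b.
  pose D := a @` (chart_dom a `&` V).
  have oD : open D by exact: open_chart_image_sub.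
  have Dp : D (a p) by exists p.
  have VU : V `<=` U by move=> q [].
  have sF : smooth_on D F.
    apply: smooth_on_sub (smooth_chart_submersion hf aA bA).
    by move=> _ [q [aq [_ bq]] <-]; exists q.
  have Sp : submersion_dom f a b (a p) by exists p.
  (* A horizontal field coincides near [p] with the lift of its own, usually non-constant,
     projection, so its derivative can be computed on that lift. *)
  have lift Z : smooth_field U Z -> (forall q, U q -> Z q \in horizontal gM f q) ->
      differentiable (fun y => 'd F y (field_in_chart a Z y)) (a p) /\
      forall u, 'd (field_in_chart a Z) (a p) u =
        'd (fun y => L y ('d F y (field_in_chart a Z y))) (a p) u.
    move=> sZ hZ; have sZa := smooth_field_sub VU sZ aA.
    split; first exact: smooth_on_differentiable (smooth_on_diff_app oD sF sZa) Dp.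
    move=> u; apply: (diff_eq_on u oD Dp);
      last exact: smooth_on_differentiable sZa Dp.
    move=> _ [q [aq [Uq bq]] <-]; rewrite field_in_chartE//.
    by apply/esym; apply: chart_lift_horizontal => //; exact: hZ.
  have [dX eX] := lift X sX (fun q Uq => (XYh q Uq).1).
  have [dY eY] := lift Y sY (fun q Uq => (XYh q Uq).2).
  have LE Z : Z p \in horizontal gM f p ->
      L (a p) ('d F (a p) (field_in_chart a Z (a p))) = field_in_chart a Z (a p).
    by move=> hZ; rewrite field_in_chartE//; exact: chart_lift_horizontal.
  have [hX hY] := XYh p Up.
  have e1 := lie_bracket_chart aA ap oU Up sX sY.
  rewrite tangent_coord_at in e1.
  have e2 := lift_field_bracket lS Sp dX dY.
  have TE Z : 'd F (a p) (field_in_chart a Z (a p)) = tangent_map f p (Z p).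
    by rewrite field_in_chartE// tangent_coord_at; exact: diff_chart_submersion_at.
  have e3 : local_bracket (field_in_chart a X) (field_in_chart a Y) (a p) =
    local_bracket (fun q => L q ('d F q (field_in_chart a X q)))
      (fun q => L q ('d F q (field_in_chart a Y q))) (a p).
    apply: (congr2 (fun u v => u - v)).
      exact: etrans (eY _) (congr1 _ (esym (LE X hX))).
    exact: etrans (eX _) (congr1 _ (esym (LE Y hY))).
  have e4 : local_bracket (L ^~ ('d F (a p) (field_in_chart a X (a p))))
      (L ^~ ('d F (a p) (field_in_chart a Y (a p)))) (a p) = 0.
    by rewrite (TE X) (TE Y); exact: B0 p _ _ hX hY.
  rewrite (etrans e1
    (etrans e3 (etrans e2 (etrans (congr1 (+%R^~ _) e4) (add0r _))))).
  have hL w : L (a p) w \in horizontal gM f p.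
    by have := horizontal_chart_lift aA bA w ap bfp; rewrite coord_field_at.
  exact: hL.
move=> hI p x y hx hy.
pose a := chart_at p; pose b := chart_at (f p).
have aA : atlas a := atlas_chart_at p; have bA : atlas b := atlas_chart_at (f p).
have ap : chart_dom a p := dom_chart_at p.
have bfp : chart_dom b (f p) := dom_chart_at (f p).
pose U := chart_dom a `&` f @^-1` chart_dom b.
have oU : open U by apply: openI; [exact: open_chart_dom|exact: open_preimage hf b].
have Up : U p by [].
have UE : a @` U = submersion_dom f a b by [].
have Ua : U `<=` chart_dom a by move=> q [].
pose e u := chart_field a (chart_lift a b ^~ (tangent_map f p u)).
have se u : smooth_field U (e u).
  by apply: smooth_chart_field => //; rewrite UE; exact: chart_lift_smooth.
have he u q : U q -> e u q \in horizontal gM f q.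
  by move=> [aq bq]; exact: horizontal_chart_lift.
have hb := hI U (e x) (e y) oU (se x) (se y)
  (fun q Uq => conj (he x q Uq) (he y q Uq)) p Up.
have e1 := lie_bracket_chart aA ap oU Up (se x) (se y).
rewrite tangent_coord_at in e1.
have Sp : submersion_dom f a b (a p) by exists p.
have oS : open (submersion_dom f a b)
  by exact: (@open_submersion_dom _ _ _ _ _ _ _ _ hf a b).
have eE u z : submersion_dom f a b z ->
    chart_lift a b z (tangent_map f p u) = field_in_chart a (e u) z.
  by move=> [q [aq bq] <-]; rewrite field_in_chartE// /e /chart_field coord_fieldK.
have dE u v : 'd (chart_lift a b ^~ (tangent_map f p u)) (a p) v =
    'd (field_in_chart a (e u)) (a p) v.
  apply: (diff_eq_on v oS Sp (eE u)).
  exact: smooth_on_differentiable (chart_lift_smooth aA bA _) Sp.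
have e2 : oneill_bracket p x y = lie_bracket (e x) (e y) p.
  rewrite e1; apply: (congr2 (fun u v => u - v)).
    exact: etrans (dE y _) (congr1 _ (eE x _ Sp)).
  exact: etrans (dE x _) (congr1 _ (eE y _ Sp)).
(* Integrability makes the bracket horizontal, and brackets of lifts are always vertical. *)
have : oneill_bracket p x y \in (horizontal gM f p :&: vertical f p)%VS.
  by rewrite memv_cap oneill_bracket_vertical e2 hb.
by rewrite horizontal_vertical0 memv0 => /eqP.
Qed.

End Lift.

(** * Quaternionic space forms *)

Section Orthonormal.
Context {R : realType} {n : nat} {M : manifold R n}.
Variables (g : metric M) (p : M).
Implicit Types (x y z : 'rV[R]_n) (U : {vspace 'rV[R]_n}).

Lemma innerDl x y z : inner g p (x + y) z = inner g p x z + inner g p y z.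
Proof. by rewrite !(inner_sym _ _ _ z) (linear_funD (inner_linear g p z)). Qed.

Lemma innerZl a x z : inner g p (a *: x) z = a * inner g p x z.
Proof. by rewrite !(inner_sym _ _ _ z) (linear_funZ (inner_linear g p z)). Qed.

Lemma innerBl x y z : inner g p (x - y) z = inner g p x z - inner g p y z.
Proof. by rewrite innerDl -scaleN1r innerZl mulN1r. Qed.

Lemma inner_suml I (r : seq I) (F : I -> 'rV[R]_n) z :
  inner g p (\sum_(i <- r) F i) z = \sum_(i <- r) inner g p (F i) z.
Proof.
rewrite inner_sym (linear_fun_sum _ _ _ (inner_linear g p z)).
by apply: eq_bigr => i _; rewrite inner_sym.
Qed.

Lemma innerZr a x z : inner g p x (a *: z) = a * inner g p x z.
Proof. by rewrite inner_sym innerZl inner_sym. Qed.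

Definition orthonormal_tuple d (X : d.-tuple 'rV[R]_n) :=
  forall i j, inner g p (tnth X i) (tnth X j) = (i == j)%:R.

Lemma inner_orthonormal_sum d (X : d.-tuple 'rV[R]_n) (k : 'I_d -> R) j :
  orthonormal_tuple X -> inner g p (\sum_i k i *: tnth X i) (tnth X j) = k j.
Proof.
move=> oX; rewrite inner_suml (bigD1 j)//=
  innerZl oX eqxx mulr1 big1 ?addr0// => i ij.
by rewrite innerZl oX (negbTE ij) mulr0.
Qed.

Lemma orthonormal_free d (X : d.-tuple 'rV[R]_n) : orthonormal_tuple X -> free X.
Proof.
move=> oX; apply/freeP => k k0 j; rewrite -(inner_orthonormal_sum k j oX).
have -> : \sum_i k i *: tnth X i = 0.
  by rewrite -[RHS]k0; apply: eq_bigr => i _; rewrite (tnth_nth 0).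
exact: linear_fun0
  (fun a u v => etrans (innerDl (a *: u) v _) (congr1 (+%R^~ _) (innerZl a u _))).
Qed.

(** Gram-Schmidt by induction on [d]: a vector of [U] outside the span of the previous ones, minus
    its projection, is normalized. *)
Lemma exists_orthonormal U d : (d <= \dim U)%N ->
  exists X : d.-tuple 'rV[R]_n, (forall i, tnth X i \in U) /\ orthonormal_tuple X.
Proof.
elim: d => [_|d IH dU]; first by exists [tuple]; split=> -[].
have [X [XU oX]] := IH (ltnW dU).
have /subvPn[y Uy Xy] : ~~ (U <= <<X>>)%VS.
  apply/negP => /dimvS UX; have := leq_trans dU (leq_trans UX (dim_span X)).
  by rewrite size_tuple ltnn.
pose P := \sum_i inner g p y (tnth X i) *: tnth X i.
pose y' := y - P.
have PX : P \in <<X>>%VS by apply: memv_suml => i _;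
  rewrite memvZ// memv_span// mem_tnth.
have PU : P \in U by apply: memv_suml => i _; rewrite memvZ.
have y'0 : y' != 0.
  by apply: contraNneq Xy => /eqP; rewrite subr_eq0 => /eqP ->.
have y'X j : inner g p y' (tnth X j) = 0.
  by rewrite innerBl inner_orthonormal_sum// subrr.
have N0 : 0 < inner g p y' y' by exact: metric_pos.
pose s := Num.sqrt (inner g p y' y').
have s0 : s != 0 by rewrite gt_eqF// sqrtr_gt0.
exists [tuple of s^-1 *: y' :: X]; split.
  move=> i; case: (unliftP ord0 i) => [j ->|->]; first by rewrite tnthS.
  by rewrite tnth0 memvZ// memvB.
move=> i j; case: (unliftP ord0 i) => [i' ->|->];
  case: (unliftP ord0 j) => [j' ->|->].
- by rewrite !tnthS oX (inj_eq lift_inj).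
- by rewrite tnthS tnth0 innerZr inner_sym y'X mulr0.
- by rewrite tnthS tnth0 innerZl y'X mulr0.
- rewrite !tnth0 innerZl innerZr eqxx -[inner _ _ _ _]sqr_sqrtr ?ltW// -/s.
  by rewrite expr2 mulKf// mulVf.
Qed.

Lemma exists_orthonormal_basis U d : \dim U = d ->
  exists X : d.-tuple 'rV[R]_n, basis_of U X /\ orthonormal_tuple X.
Proof.
move=> Ud; have [X [XU oX]] := @exists_orthonormal U d (eq_leq (esym Ud)).
exists X; split=> //;
  rewrite basisEfree orthonormal_free// size_tuple Ud leqnn andbT /=.
by apply/span_subvP => x /tnthP[i ->].
Qed.

Lemma orthonormal_expansion U d (X : d.-tuple 'rV[R]_n) x :
  basis_of U X -> orthonormal_tuple X -> x \in U ->
  x = \sum_i inner g p x (tnth X i) *: tnth X i.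
Proof.
move=> bX oX Ux; have e := coord_basis bX Ux.
have {}e : x = \sum_i coord X i x *: tnth X i.
  by rewrite [LHS]e; apply: eq_bigr => i _; rewrite (tnth_nth 0).
by rewrite {1}e; apply: eq_bigr => i _; rewrite {2}e inner_orthonormal_sum.
Qed.

Lemma parseval U d (X : d.-tuple 'rV[R]_n) x :
  basis_of U X -> orthonormal_tuple X -> x \in U ->
  \sum_i inner g p x (tnth X i) ^+ 2 = inner g p x x.
Proof.
move=> bX oX Ux; rewrite {2}(orthonormal_expansion bX oX Ux) inner_suml.
by apply: eq_bigr => i _; rewrite innerZl inner_sym expr2.
Qed.

End Orthonormal.

(** * Sectional and Ricci-type curvatures of the space form *)

Section QuaternionicSpaceForm.
Context {R : realType} {m k : nat} {M : manifold R (4 * m)%N} {N : manifold R k}.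
Variables (c : R) (gM : metric M) (gN : metric N)
  (E : M -> {vspace 'End('rV[R]_(4 * m)%N)}).
Variables (nablaM : (M -> 'rV[R]_(4 * m)%N) -> (M -> 'rV[R]_(4 * m)%N) -> M ->
  'rV[R]_(4 * m)%N).
Variables (nablaN : (N -> 'rV[R]_k) -> (N -> 'rV[R]_k) -> N -> 'rV[R]_k).
Hypothesis hform : quaternionic_space_form gM E nablaM c.
Variables (U : set M) (J : 'Z_3 -> M -> 'End('rV[R]_(4 * m)%N)) (p : M).
Hypotheses (hJ : canonical_basis gM E U J) (Up : U p).

Lemma inner_skew a x y : inner gM p (J a p y) x = - inner gM p (J a p x) y.
Proof.
rewrite -(canonical_hermitian hJ a (J a p y) x Up) (canonical_sqr hJ)//.
by rewrite -scaleN1r innerZl mulN1r inner_sym.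
Qed.

(** Each [J a p] is skew, so its first term vanishes, while the second and third give once and twice
    the same square; hence the factor [3]. *)
Lemma inner_curvature x y : inner gM p (curvature nablaM p x y y) x =
  c / 4 * (inner gM p x x * inner gM p y y - inner gM p x y ^+ 2 +
           \sum_(a : 'Z_3) 3 * inner gM p (J a p x) y ^+ 2).
Proof.
have [_ hR] := hform; rewrite (hR _ _ hJ _ Up) innerZl innerDl; congr (_ * _);
  congr (_ + _).
  by rewrite innerBl !innerZl (inner_sym _ _ y x) mulrC expr2.
rewrite inner_suml; apply: eq_bigr => a _.
have s x' : inner gM p (J a p x') x' = 0.
  by have := inner_skew a x' x'; lra.
rewrite innerDl innerBl !innerZl (inner_skew a x y) !s.
by ring.
Qed.

Variable f : M -> N.
Hypotheses (hM : levi_civita gM nablaM) (hN : levi_civita gN nablaN).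
Hypothesis hf : riemannian_submersion gM gN f.

(** An exact formula for the defect in the inequality. Parseval for the unit vector [x] gives the
    [- 1], and projecting [J a p x] is harmless because it is paired with horizontal vectors. *)
Lemma ric_starE l x (X : l.-tuple 'rV[R]_(4 * m)%N) :
  x \in horizontal gM f p -> inner gM p x x = 1 -> horizontal_onb gM f p X ->
  ric_star gM f nablaN p X x =
    c / 4 * ((l%:R - 1) + \sum_(j < l) \sum_(a : 'Z_3)
      3 * inner gM p (C_part gM f p (J a p) x) (tnth X j) ^+ 2) -
    3 / 4 * \sum_(j < l) inner gM p (oneill_bracket gM gN f p x (tnth X j))
                                   (oneill_bracket gM gN f p x (tnth X j)).
Proof.
move=> hx x1 [bX oX].
have hX j : tnth X j \in horizontal gM f p by exact: basis_mem bX (mem_tnth j X).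
have -> : l%:R - 1 = \sum_(j < l) (1 - inner gM p x (tnth X j) ^+ 2).
  by rewrite sumrB (parseval bX oX hx) x1 sumr_const card_ord.
rewrite -big_split /= !mulr_sumr -sumrB; apply: eq_bigr => j _.
rewrite (oneill hM hN hf hx (hX j)) inner_curvature x1 oX eqxx mul1r.
congr (_ * (_ + _) - _); apply: eq_bigr => a _.
by rewrite /C_part (inner_hproj _ (hX j)).
Qed.

End QuaternionicSpaceForm.

Theorem theorem3p3 (R : realType) (m n l : nat) (c : R)
    (M : manifold R (4 * m)%N) (N : manifold R n)
    (gM : metric M) (gN : metric N)
    (E : M -> {vspace 'End('rV[R]_(4 * m)%N)})
    (nablaM : (M -> 'rV[R]_(4 * m)%N) -> (M -> 'rV[R]_(4 * m)%N) ->
              M -> 'rV[R]_(4 * m)%N)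
    (nablaN : (N -> 'rV[R]_n) -> (N -> 'rV[R]_n) -> N -> 'rV[R]_n)
    (pi : M -> N)
    (hM : levi_civita gM nablaM)
    (hN : levi_civita gN nablaN)
    (hform : quaternionic_space_form gM E nablaM c)
    (hpi : riemannian_submersion gM gN pi)
    (hanti : anti_invariant gM E pi)
    (hl : forall p : M, \dim (horizontal gM pi p) = l) :
  (forall (U : set M) (J : 'Z_3 -> M -> 'End('rV[R]_(4 * m)%N)) (p : M)
      (x : 'rV[R]_(4 * m)%N) (X : l.-tuple 'rV[R]_(4 * m)%N),
    canonical_basis gM E U J -> U p ->
    x \in horizontal gM pi p -> inner gM p x x = 1 ->
    horizontal_onb gM pi p X ->
    ric_star gM pi nablaN p X x <=
      c / 4 * ((l%:R - 1) + \sum_(j < l) \sum_(a : 'Z_3)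
        3 * inner gM p (C_part gM pi p (J a p) x) (tnth X j) ^+ 2))
  /\
  ((forall (U : set M) (J : 'Z_3 -> M -> 'End('rV[R]_(4 * m)%N)) (p : M)
      (x : 'rV[R]_(4 * m)%N) (X : l.-tuple 'rV[R]_(4 * m)%N),
    canonical_basis gM E U J -> U p ->
    x \in horizontal gM pi p -> inner gM p x x = 1 ->
    horizontal_onb gM pi p X ->
    ric_star gM pi nablaN p X x =
      c / 4 * ((l%:R - 1) + \sum_(j < l) \sum_(a : 'Z_3)
        3 * inner gM p (C_part gM pi p (J a p) x) (tnth X j) ^+ 2))
   <-> horizontal_integrable gM pi).
Proof.
have inner_ge0 p v : 0 <= inner gM p v v.
  have [->|v0] := eqVneq v 0; last exact/ltW/metric_pos.
  by rewrite (linear_fun0 (inner_linear gM p 0)).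
split=> [U J p x X hJ Up hx x1 hX|].
  rewrite (ric_starE hform hJ Up hM hN hpi hx x1 hX) lerBlDr lerDl.
  by apply: mulr_ge0; [rewrite divr_ge0|apply: sumr_ge0 => j _].
rewrite -(oneill_bracket_eq0_integrable hM hN hpi); split; last first.
  move=> B0 U J p x X hJ Up hx x1 hX.
  rewrite (ric_starE hform hJ Up hM hN hpi hx x1 hX) [X in _ - _ * X]big1 ?mulr0
    ?subr0// => j _.
  rewrite B0//; first exact: (linear_fun0 (inner_linear gM p 0)).
  exact: basis_mem hX.1 (mem_tnth j X).
move=> eqric p x y hx hy.
have lin := oneill_bracket_linear hM hN hpi p.
have [x0|x0] := eqVneq x 0.
  by rewrite oneill_bracketC x0 (linear_fun0 (lin y)) oppr0.
(* The equality is assumed relative to a canonical basis, an orthonormal basis and a unit vector, so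
   all three have to be produced at [p]; [u] below is [x] normalized. *)
have [U [J [hJ Up]]] := hform.1.1 p.
have [X [bX oX]] := exists_orthonormal_basis gM p (hl p).
pose s := Num.sqrt (inner gM p x x).
have N0 : 0 < inner gM p x x by exact: metric_pos.
have s0 : s != 0 by rewrite gt_eqF// sqrtr_gt0.
pose u := s^-1 *: x.
have hu : u \in horizontal gM pi p by rewrite memvZ.
have u1 : inner gM p u u = 1.
  by rewrite innerZl innerZr -[inner _ _ _ _]sqr_sqrtr ?ltW// -/s expr2 mulKf//
    mulVf.
have := eqric U J p u X hJ Up hu u1 (conj bX oX).
rewrite (ric_starE hform hJ Up hM hN hpi hu u1 (conj bX oX)) => /eqP.
(* The terms with [c] cancel whatever its sign, leaving [3 / 4] times a vanishing sum of squared
   norms. *)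
rewrite eq_sym -subr_eq0 opprB addrC subrK mulf_eq0 mulf_eq0 invr_eq0 !pnatr_eq0 /=.
rewrite psumr_eq0// => /allP B0.
have BuX j : oneill_bracket gM gN pi p u (tnth X j) = 0.
  have := B0 j (mem_index_enum j); rewrite /= => /eqP; exact: inner_eq0.
have Buy : oneill_bracket gM gN pi p u y = 0.
  rewrite (orthonormal_expansion bX oX hy) (linear_fun_sum _ _ _ (lin u)).
  by apply: big1 => j _; rewrite (linear_funZ (lin u)) BuX scaler0.
have -> : x = s *: u by rewrite /u scalerA mulfV// scale1r.
(* Linearity is available in the second argument only; antisymmetry carries the scalar there and
   back. *)
by rewrite oneill_bracketC
  (linear_funZ (lin y)) oneill_bracketC Buy oppr0 scaler0 oppr0.
Qed.
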